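(* Let $n\ge 1$ and let $T:\mathbb{C}[z_1,\ldots,z_n]\to\mathbb{C}[z_1,\ldots,z_n]$ be a $\mathbb{C}$-linear operator. Then $T$ preserves $\mathbb{H}_0$-stability if and only if either (a) $T$ has range of dimension at most one and is of the form $T(f)=\alpha(f)P$, where $\alpha$ is a linear form on $\mathbb{C}[z_1,\ldots,z_n]$ and $P$ is an $\mathbb{H}_0$-stable polynomial, or (b) the formal power series $$T[e^{-z\cdot w}]:=\sum_{\alpha\in\mathbb{N}^n}(-1)^{\alpha}\,T(z^\alpha)\frac{w^\alpha}{\alpha!}\in\mathbb{C}[z_1,\ldots,z_n][[w_1,\ldots,w_n]]$$ is an entire function (of the $2n$ variables $z_1,\ldots,z_n,w_1,\ldots,w_n$) which is the limit, uniformly on compact sets, of $\mathbb{H}_0$-stable polynomials (in these $2n$ variables).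
   Context: $\mathbb{N}=\{0,1,2,\ldots\}$. $\mathbb{H}_0=\{\zeta\in\mathbb{C}:\operatorname{Im}(\zeta)>0\}$. A polynomial $f\in\mathbb{C}[z_1,\ldots,z_m]$ is $\mathbb{H}_0$-stable if $f(z_1,\ldots,z_m)\neq 0$ whenever $z_i\in\mathbb{H}_0$ for all $1\le i\le m$. The operator $T$ preserves $\mathbb{H}_0$-stability if for every $\mathbb{H}_0$-stable polynomial $f\in\mathbb{C}[z_1,\ldots,z_n]$, the polynomial $T(f)$ is either $\mathbb{H}_0$-stable or identically $0$. Multi-index notation: for $\alpha=(\alpha_1,\ldots,\alpha_n)\in\mathbb{N}^n$, $z^\alpha=z_1^{\alpha_1}\cdots z_n^{\alpha_n}$, $w^\alpha=w_1^{\alpha_1}\cdots w_n^{\alpha_n}$, $\alpha!=\alpha_1!\cdots\alpha_n!$, $(-1)^\alpha=(-1)^{\alpha_1+\cdots+\alpha_n}$, and $z\cdot w=z_1w_1+\cdots+z_nw_n$. *)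

(* Defs.v *)
From mathcomp Require Import all_boot all_order all_algebra.
(* mpoly has to be imported before the MathComp-Analysis files: in the other
   order the levels of their notations are incompatible. *)
From mathcomp Require Import mpoly finmap complex.
From mathcomp Require Import all_classical all_reals all_analysis summability.

Set Implicit Arguments.
Unset Strict Implicit.
Unset Printing Implicit Defensive.

Import Order.TTheory GRing.Theory Num.Theory.
Import numFieldNormedType.Exports.

Local Open Scope ring_scope.
Local Open Scope classical_set_scope.

(* The complex numbers are R[i], for R : realType.  R[i] itself carries no
   topology in the library; its usual one is reached through R[i]^o, which is
   convertible to R[i]. *)

Definition H0 (R : realType) : set R[i] := [set z | 0 < complex.Im z].

Definition stable (R : realType) (m : nat) (f : {mpoly R[i][m]}) : Prop :=
  forall z : 'I_m -> R[i], (forall i, H0 (z i)) -> f.@[z] != 0.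

Definition preserves_stability (R : realType) (n : nat)
    (T : {linear {mpoly R[i][n]} -> {mpoly R[i][n]}}) : Prop :=
  forall f : {mpoly R[i][n]}, stable f -> stable (T f) \/ T f = 0.

(* Formal power series in m variables are given by their coefficients,
   as functions 'X_{1..m} -> A. *)

Definition mfactorial (n : nat) (a : 'X_{1..n}) : nat :=
  (\prod_(i < n) (a i)`!)%N.

(* T[e^{-z.w}] as a power series in w with coefficients in C[z]. *)
Definition symbol (R : realType) (n : nat)
    (T : {linear {mpoly R[i][n]} -> {mpoly R[i][n]}}) :
    'X_{1..n} -> {mpoly R[i][n]} :=
  fun a => ((-1) ^+ mdeg a / (mfactorial a)%:R) *: T 'X_[a].

(* The embedding of C[z][[w]] into C[[z, w]]: the first n of the n + n
   variables are z, the last n are w. *)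
Definition joint_series (R : realType) (n : nat)
    (S : 'X_{1..n} -> {mpoly R[i][n]}) : 'X_{1..n + n} -> R[i] :=
  fun k => (S [multinom k (rshift n i) | i < n])
             @_[multinom k (lshift n i) | i < n].

(* The power series c converges, unconditionally (hence absolutely), at every
   point x of C^m, with sum F x: that is, c is the entire function F. *)
Definition is_entire_function (R : realType) (m : nat)
    (c : 'X_{1..m} -> R[i]) (F : 'rV[R[i]^o]_m -> R[i]^o) : Prop :=
  forall x : 'rV[R[i]^o]_m,
    partial_sum
      (fun k : 'X_{1..m} => c k * \prod_(i < m) x ord0 i ^+ k i : R[i]^o)
      @ totally --> F x.

Definition mpoly_fun (R : realType) (m : nat) (p : {mpoly R[i][m]}) :
    'rV[R[i]^o]_m -> R[i]^o :=
  fun x => p.@[x ord0].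

Definition compact_limit_of_stable (R : realType) (m : nat)
    (F : 'rV[R[i]^o]_m -> R[i]^o) : Prop :=
  exists p : nat -> {mpoly R[i][m]},
    (forall k, stable (p k)) /\
    {family compact, (fun k => mpoly_fun (p k)) @ \oo --> F}.

Definition range_dim_le1 (R : realType) (n : nat)
    (T : {linear {mpoly R[i][n]} -> {mpoly R[i][n]}}) : Prop :=
  exists Q : {mpoly R[i][n]}, forall f, exists c : R[i], T f = c *: Q.

(* Main.v *)
(* Write F(z, w) = T[e^{-z.w}].

   (b) implies preservation.  T f is f(-d/dw) F(z, w) at w = 0.  For stable
   polynomials f(u) and p(z, w), the polynomial f(-d/dw) p(z, w)|_(w = 0) is
   obtained from f(u) p(z, w) by applying, for each i,
   exp(-d_(u_i) d_(w_i))|_(u_i = w_i = 0), which is the limit over N of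
   (1 - d_(u_i) d_(w_i) / N)^N|_(u_i = w_i = 0).  Each 1 - c d_u d_w with c >= 0
   preserves stability (up to 0) because d_u p / p has nonpositive imaginary
   part on the half planes, so Hurwitz' theorem shows that T f is stable or 0.

   Preservation implies (a) or (b).  Suppose that T kills prod_i (z_i + w_i)^N for
   some w in the half planes.  As this product can be perturbed by any g of
   degree at most N in each variable, T g is stable or 0 for all these g, so T
   has rank at most 1 on them.  If this happens for all N we are in case (a).
   Otherwise, for N large, p_N = T[prod_i (1 - z_i w_i / N)^N] is stable in 2n
   variables, and its coefficients are those of F, multiplied by factors in
   [0, 1] which tend to 1.  It remains to see that the coefficients of F decay
   faster than any geometric sequence.  On a real direction v with entries in
   [1, 2], t |-> p_N(t v) is a stable univariate polynomial, which is bounded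
   (Szasz) in terms of its three lowest coefficients; the lowest one stays away
   from 0 because the lowest homogeneous part of F is stable.  Cauchy's
   estimates bound the homogeneous parts of p_N on these v, and finite
   differences recover their coefficients. *)

Require Import Defs.
From HB Require Import structures.
From mathcomp Require Import all_boot all_order all_algebra.
From mathcomp Require Import mpoly ssrcomplements finmap complex.
From mathcomp Require Import all_classical all_reals all_analysis summability.
From mathcomp Require Import cyclic separable cyclotomic ring lra zify.

Set Implicit Arguments.
Unset Strict Implicit.
Unset Printing Implicit Defensive.

Import Order.TTheory GRing.Theory Num.Theory.
Import numFieldNormedType.Exports.
Import ComplexField UnityRootTheory.

Local Open Scope ring_scope.
Local Open Scope classical_set_scope.

(* The modulus as an element of R: the norm [`|x|] of R[i] has values in R[i]. *)
Local Notation nrm := (@Normc.normc _).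
Local Notation Re := (@complex.Re _).
Local Notation Im := (@complex.Im _).

(** * The modulus, roots of unity and univariate estimates *)

Section Modulus.
Variable R : realType.
Local Notation C := R[i].
Implicit Types x y z : C.

Lemma nrm_ge0 x : 0 <= nrm x.
Proof. by case: x => a b; rewrite sqrtr_ge0. Qed.

Lemma nrm0 : nrm (0 : C) = 0. Proof. exact: Normc.normc0. Qed.

Lemma nrm1 : nrm (1 : C) = 1. Proof. exact: Normc.normc1. Qed.

Lemma nrm_eq0 x : (nrm x == 0) = (x == 0).
Proof. by apply/eqP/eqP => [/Normc.eq0_normc|->] //; rewrite nrm0. Qed.

Lemma nrm_gt0 x : (0 < nrm x) = (x != 0).
Proof. by rewrite lt_def nrm_eq0 nrm_ge0 andbT. Qed.

Lemma nrmM x y : nrm (x * y) = nrm x * nrm y.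
Proof. exact: Normc.normcM. Qed.

Lemma nrmV x : nrm x^-1 = (nrm x)^-1.
Proof. exact: Normc.normcV. Qed.

Lemma nrmD x y : nrm (x + y) <= nrm x + nrm y.
Proof. exact: le_normcD. Qed.

Lemma nrmN x : nrm (- x) = nrm x.
Proof. exact: normcN. Qed.

Lemma nrmB x y : nrm (x - y) <= nrm x + nrm y.
Proof. by rewrite -(nrmN y) nrmD. Qed.

Lemma nrm_distC x y : nrm (x - y) = nrm (y - x).
Proof. by rewrite -nrmN opprB. Qed.

Lemma nrm_lerB x y : nrm x - nrm y <= nrm (x - y).
Proof. by rewrite lerBlDr -{1}(subrK y x) nrmD. Qed.

Lemma nrmX x k : nrm (x ^+ k) = nrm x ^+ k.
Proof. by elim: k => [|k IH]; rewrite ?expr0 ?nrm1 // !exprS nrmM IH. Qed.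

Lemma nrm_sum I (s : seq I) (P : pred I) (F : I -> C) :
  nrm (\sum_(i <- s | P i) F i) <= \sum_(i <- s | P i) nrm (F i).
Proof.
elim/big_ind2: _ => [|a x b y ax yb|i _] //; first by rewrite nrm0.
exact: le_trans (nrmD _ _) (lerD _ _).
Qed.

Lemma nrm_prod I (s : seq I) (P : pred I) (F : I -> C) :
  nrm (\prod_(i <- s | P i) F i) = \prod_(i <- s | P i) nrm (F i).
Proof. exact: (big_morph _ (@nrmM) nrm1). Qed.

Lemma nrm_sqr x : nrm x ^+ 2 = Re x ^+ 2 + Im x ^+ 2.
Proof. by case: x => a b; rewrite sqr_sqrtr // addr_ge0 ?sqr_ge0. Qed.

Lemma nrm_real (r : R) : nrm r%:C%C = `|r|.
Proof. by rewrite /= expr0n /= addr0 sqrtr_sqr. Qed.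

Lemma normCE x : `|x| = (nrm x)%:C%C.
Proof. by []. Qed.

Lemma nrm_nat k : nrm (k%:R : C) = k%:R.
Proof. by rewrite -(rmorph_nat (real_complex R)) nrm_real ger0_norm ?ler0n. Qed.

Lemma Im_le_nrm x : `|Im x| <= nrm x.
Proof. by rewrite -sqrtr_sqr; case: x => a b /=; rewrite ler_sqrt ?lerDr ?addr_ge0 ?sqr_ge0. Qed.

Lemma Re_le_nrm x : `|Re x| <= nrm x.
Proof. by rewrite -sqrtr_sqr; case: x => a b /=; rewrite ler_sqrt ?lerDl ?addr_ge0 ?sqr_ge0. Qed.

Lemma nrm_le_ReIm x : nrm x <= `|Re x| + `|Im x|.
Proof.
have -> : x = (Re x)%:C%C + (0 +i* Im x)%C by case: x => a b; apply/eqP;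
  rewrite eq_complex /= addr0 add0r !eqxx.
apply: le_trans (nrmD _ _) _; rewrite nrm_real /= !addr0 ?add0r lerD2l.
by rewrite expr0n /= add0r sqrtr_sqr.
Qed.

Lemma ReD x y : Re (x + y) = Re x + Re y. Proof. by case: x y => ? ? []. Qed.
Lemma ImD x y : Im (x + y) = Im x + Im y. Proof. by case: x y => ? ? []. Qed.
Lemma ReN x : Re (- x) = - Re x. Proof. by case: x. Qed.
Lemma ImN x : Im (- x) = - Im x. Proof. by case: x. Qed.
Lemma ReM x y : Re (x * y) = Re x * Re y - Im x * Im y. Proof. by case: x y => ? ? []. Qed.
Lemma ImV x : Im x^-1 = - Im x / nrm x ^+ 2. 
Proof. by rewrite nrm_sqr; case: x => a b /=; rewrite mulNr. Qed.

Lemma Re_sum I (s : seq I) (P : pred I) (F : I -> C) :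
  Re (\sum_(i <- s | P i) F i) = \sum_(i <- s | P i) Re (F i).
Proof. exact: (big_morph (@complex.Re R) ReD (erefl _)). Qed.

Lemma Im_sum I (s : seq I) (P : pred I) (F : I -> C) :
  Im (\sum_(i <- s | P i) F i) = \sum_(i <- s | P i) Im (F i).
Proof. exact: (big_morph (@complex.Im R) ImD (erefl _)). Qed.

(** [X^N - 1] splits over the complex numbers and is separable, so it has [N] distinct roots, among
    which there is a primitive one. *)
Lemma prim_root_exists N : (0 < N)%N -> exists w : C, N.-primitive_root w.
Proof.
pose p : {poly C} := 'X^N - 1; have [r Dp] := closed_field_poly_normal p.
move=> N_gt0; rewrite (monicP _) ?monicXnsubC // scale1r in Dp.
have rn1: all N.-unity_root r by apply/allP=> z; rewrite -root_prod_XsubC -Dp.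
have sz_r: (N < (size r).+1)%N.
  by rewrite -(size_prod_XsubC r id) -Dp size_XnsubC.
have [|z] := hasP (has_prim_root N_gt0 rn1 _ sz_r); last by exists z.
by rewrite -separable_prod_XsubC -Dp separable_Xn_sub_1 // pnatr_eq0 -lt0n.
Qed.

Lemma prim_root_nrm N (w : C) : N.-primitive_root w -> nrm w = 1.
Proof.
move=> wN; have N0 := prim_order_gt0 wN.
by apply/eqP; rewrite -(@pexpr_eq1 _ _ N) ?nrm_ge0 -?lt0n // -nrmX (prim_expr_order wN) nrm1.
Qed.

(** Orthogonality of characters: [w^k - 1] times the sum is [w^(kN) - 1 = 0], and [w^k - 1] vanishes
    only if [N] divides [k]. *)
Lemma sum_prim_root N (w : C) (k : nat) : N.-primitive_root w ->
  \sum_(j < N) w ^+ (j * k) = if (N %| k)%N then N%:R else 0.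
Proof.
move=> wN; have [Nk|Nk] := ifP.
  rewrite (eq_bigr (fun _ => 1)) ?sumr_const ?card_ord // => j _.
  by apply/eqP; rewrite -(prim_order_dvd wN) dvdn_mull.
have wk1 : w ^+ k - 1 != 0 by rewrite subr_eq0 -(prim_order_dvd wN) Nk.
have := subrX1 (w ^+ k) N.
rewrite -exprM mulnC exprM (prim_expr_order wN) expr1n subrr => /eqP.
rewrite eq_sym mulf_eq0 (negPf wk1) /= => /eqP E0; rewrite -[RHS]E0.
by apply: eq_bigr => j _; rewrite -exprM mulnC.
Qed.

End Modulus.

(** * Minimum modulus and Cauchy estimates by averaging over roots of unity *)

Section Univariate.
Variable R : realType.
Local Notation C := R[i].

(** The factorization of [X^N - 1] over the powers of [w], evaluated at [y / x] and homogenized;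
    taking moduli removes the signs. *)
Lemma prod_root_XsubC N (w x y : C) : N.-primitive_root w ->
  nrm (\prod_(j < N) (x * w ^+ j - y)) = nrm (y ^+ N - x ^+ N).
Proof.
move=> wN; have N0 := prim_order_gt0 wN.
have [->|x0] := eqVneq x 0.
  rewrite expr0n eqn0Ngt N0 subr0 (eq_bigr (fun _ => - y)).
    by rewrite prodr_const card_ord !nrmX nrmN.
  by move=> j _; rewrite mul0r sub0r.
have E : \prod_(j < N) (y / x - w ^+ j) = (y / x) ^+ N - 1.
  transitivity ('X^N - 1 : {poly C}).[y / x]; last by rewrite hornerD hornerN hornerXn hornerC.
  rewrite -(factor_Xn_sub_1 wN) big_mkord horner_prod.
  by apply: eq_bigr => j _; rewrite hornerXsubC.
have -> : y ^+ N - x ^+ N = x ^+ N * ((y / x) ^+ N - 1).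
  by rewrite mulrBr mulr1 expr_div_n mulrCA divff ?mulr1 // expf_neq0.
rewrite -E nrmM nrmX !nrm_prod -[in X in nrm x ^+ X](card_ord N) -prodr_const -big_split /=.
apply: eq_bigr => j _; rewrite -nrmM nrm_distC mulrBr; congr (nrm (_ - _)).
by rewrite mulrCA divff ?mulr1.
Qed.

Lemma bernoulli (x : R) k : 0 <= x -> 1 + x *+ k <= (1 + x) ^+ k.
Proof.
move=> x0; elim: k => [|k IH]; first by rewrite mulr0n addr0 expr0.
rewrite exprSr; apply: le_trans (ler_wpM2r _ IH); last lra.
rewrite mulrS mulrDl mul1r mulrDr mulr1 -!addrA lerD2l addrC [leRHS]addrCA lerD2l lerDl.
by rewrite mulr_ge0 // mulrn_wge0.
Qed.

Lemma pow_bounded_le1 (x B : R) : 0 <= x ->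
  (forall k, x ^+ k.+1 <= B) -> x <= 1.
Proof.
move=> x0 xB; rewrite leNgt; apply/negP => x1.
have y0 : 0 < x - 1 by rewrite subr_gt0.
pose k := (Num.truncn (B / (x - 1))).
have kB : B / (x - 1) < k.+1%:R by exact: truncnS_gt.
have := xB k; apply/negP; rewrite -ltNge.
have := bernoulli k.+1 (ltW y0); rewrite addrCA subrr addr0.
apply: lt_le_trans; rewrite -mulr_natr.
move: kB; rewrite ltr_pdivrMr // mulrC => kB; lra.
Qed.

(** A minimum modulus principle by a power trick. The product of [|p|] over [N] equidistant points
    of the circle is [|lc|^N] times the product of the [|z^N - r^N|] over the roots [z]. As
    [|z| >= r], each factor is at most [2 |z|^N], so [(d / |p(0)|)^N] is bounded independently of
    [N], which forces the ratio to be at most 1. *)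
Lemma disc_min (p : {poly C}) (r d : R) : 0 < r ->
  (forall t, nrm t <= r -> p.[t] != 0) ->
  (forall t, nrm t = r -> d <= nrm p.[t]) -> d <= nrm p.[0].
Proof.
move=> r0 pN0 pd; have [d0|d0] := lerP d 0; first exact: le_trans d0 (nrm_ge0 _).
have p0 : 0 < nrm p.[0] by rewrite nrm_gt0 pN0 // nrm0 ltW.
have [rs Ep] := closed_field_poly_normal p.
have lc0 : lead_coef p != 0.
  by apply: contraTneq p0 => lc0; rewrite Ep lc0 scale0r horner0 nrm0 ltxx.
have rs_r t : t \in rs -> r <= nrm t.
  move=> trs; rewrite leNgt; apply/negP => /ltW tr; have := pN0 _ tr.
  rewrite Ep hornerZ mulf_eq0 (negPf lc0) -/(root _ _) root_prod_XsubC trs //.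
have main N : (0 < N)%N -> (d / nrm p.[0]) ^+ N <= 2 ^+ size rs.
  move=> N0; have [w wN] := prim_root_exists R N0.
  have nw := prim_root_nrm wN.
  pose P := \prod_(j < N) nrm p.[r%:C%C * w ^+ j].
  have dP : d ^+ N <= P.
    rewrite -[N in d ^+ N](card_ord N) -prodr_const.
    apply: ler_prod => j _; rewrite ltW //=; apply: pd.
    by rewrite nrmM nrmX nw expr1n mulr1 nrm_real ger0_norm // ltW.
  have PE : P = nrm (lead_coef p) ^+ N * \prod_(z <- rs) nrm (z ^+ N - r%:C%C ^+ N).
    have pE t : nrm p.[t] = nrm (lead_coef p) * nrm (\prod_(z <- rs) (t - z)).
      rewrite {1}Ep hornerZ horner_prod nrmM; congr (_ * nrm _).
      by apply: eq_bigr => z _; rewrite hornerXsubC.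
    rewrite /P (eq_bigr _ (fun j _ => pE _)) big_split /= prodr_const card_ord -nrm_prod.
    rewrite exchange_big /= nrm_prod.
    congr (_ * _); apply: eq_bigr => z _; by rewrite -(prod_root_XsubC _ _ wN).
  have p0E : nrm p.[0] ^+ N = nrm (lead_coef p) ^+ N * \prod_(z <- rs) nrm z ^+ N.
    rewrite {1}Ep hornerZ nrmM exprMn horner_prod nrm_prod -prodrXl; congr (_ * _).
    by apply: eq_bigr => z _; rewrite hornerXsubC sub0r nrmN.
  rewrite expr_div_n ler_pdivrMr ?exprn_gt0 //; apply: le_trans dP _.
  rewrite PE p0E mulrCA ler_wpM2l ?exprn_ge0 ?nrm_ge0 //.
  have -> : 2 ^+ size rs = \prod_(z <- rs) 2 :> R by rewrite big_const_seq count_predT iter_mulr_1.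
  rewrite -big_split /= big_seq [leRHS]big_seq; apply: ler_prod => z /rs_r rz.
  rewrite nrm_ge0 /= (le_trans (nrmB _ _)) // !nrmX nrm_real (ger0_norm (ltW r0)).
  by rewrite mulr_natl mulr2n lerD2l lerXn2r // nnegrE ?nrm_ge0 // ltW.
rewrite -[leRHS]mul1r -ler_pdivrMr //; apply: (@pow_bounded_le1 _ (2 ^+ size rs)).
  by rewrite divr_ge0 ?ltW.
by move=> k; apply: main.
Qed.

(** The average of [p(r w^j) w^(-jk)] over the powers of a root of unity [w] isolates the term of
    degree [k]. *)
Lemma cauchy_poly (p : {poly C}) (r M : R) k : 0 <= r ->
  (forall t, nrm t = r -> nrm p.[t] <= M) -> nrm p`_k * r ^+ k <= M.
Proof.
(* With [N > k] and [i < N], the exponent [i + (N - k)] lies strictly between 0 and [2 N], so [N]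
   divides it only for [i = k]. *)
move=> r0 pM; pose N := (size p + k).+1.
have [w wN] := @prim_root_exists R N isT.
have nw := prim_root_nrm wN.
have E : \sum_(j < N) p.[r%:C%C * w ^+ j] * w ^+ (j * (N - k)) = N%:R * (p`_k * r%:C%C ^+ k).
  transitivity (\sum_(i < N) p`_i * r%:C%C ^+ i * \sum_(j < N) w ^+ (j * (i + (N - k)))).
    under [RHS]eq_bigr do rewrite mulr_sumr.
    rewrite exchange_big /=; apply: eq_bigr => j _.
    rewrite (@horner_coef_wide _ N) ?mulr_suml; last by rewrite /N; lia.
    by apply: eq_bigr => i _; rewrite exprMn -exprM mulnDr exprD !mulrA.
  have kN : (k < N)%N by rewrite /N; lia.
  rewrite (bigD1 (Ordinal kN)) //= [X in _ + X]big1 ?addr0 => [|i ik].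
    by rewrite (sum_prim_root _ wN) subnKC 1?ltnW // dvdnn mulrC.
  rewrite (sum_prim_root _ wN) ifF ?mulr0 //; apply/negP => /dvdnP[q Eq].
  have : (i != k :> nat) by [].
  have := ltn_ord i; case: q Eq => [|[|q]]; rewrite ?mul0n ?mul1n ?mulSn; lia.
have : nrm (N%:R * (p`_k * r%:C%C ^+ k)) <= N%:R * M.
  rewrite -E (le_trans (nrm_sum _ _ _)) // mulr_natl -[in leRHS](card_ord N) -sumr_const.
  apply: ler_sum => j _; rewrite nrmM !nrmX nw expr1n mulr1 pM //.
  by rewrite nrmM nrmX nw expr1n mulr1 nrm_real ger0_norm.
rewrite !nrmM nrmX nrm_real (ger0_norm r0).
have -> : nrm (N%:R : C) = N%:R by exact: nrm_nat.
by rewrite ler_pM2l // ltr0n.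
Qed.

End Univariate.
(** * Univariate stable polynomials *)

Section UnivariateStable.
Variable R : realType.
Local Notation C := R[i].

Lemma logderiv_prod (rs : seq C) : {in rs, forall z, z != 0} ->
  (\prod_(z <- rs) ('X - z%:P))^`().[0] =
  - (\prod_(z <- rs) ('X - z%:P)).[0] * \sum_(z <- rs) z^-1.
Proof.
elim: rs => [|y rs IH] rs0; first by rewrite !big_nil derivC horner0 mulr0.
have y0 : y != 0 by rewrite rs0 ?mem_head.
rewrite !big_cons derivM hornerD !hornerM IH; last first.
  by move=> z zrs; rewrite rs0 // inE zrs orbT.
rewrite derivXsubC hornerC hornerXsubC.
set Q := (_).[0]; set S := \sum_(_ <- _) _; field.
exact: y0.
Qed.

(** [- q'(0) / q(0)] is the sum of the inverses of the roots; the roots lie in the open lower half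
    plane, which inversion maps to the upper one. *)
Lemma logderiv_Im (q : {poly C}) :
  (forall t, 0 <= Im t -> q.[t] != 0) -> 0 <= Im (- (q^`().[0] / q.[0])).
Proof.
move=> qN0; have q0 : q.[0] != 0 by rewrite qN0.
have [rs Eq] := closed_field_poly_normal q.
have lc0 : lead_coef q != 0.
  by apply: contraTneq q0 => lc0; rewrite Eq lc0 scale0r horner0 eqxx.
have rsIm z : z \in rs -> Im z < 0.
  move=> zrs; rewrite ltNge; apply/negP => /qN0.
  by rewrite Eq hornerZ mulf_eq0 (negPf lc0) -/(root _ _) root_prod_XsubC zrs.
have rs0 : {in rs, forall z, z != 0}.
  by move=> z /rsIm; apply: contraTneq => ->; rewrite ltxx.
have -> : - (q^`().[0] / q.[0]) = \sum_(z <- rs) z^-1.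
  move: q0; rewrite Eq derivZ !hornerZ (logderiv_prod rs0) mulf_eq0 negb_or => /andP[l0 p0].
  move: (lead_coef q) (\sum_(z <- rs) z^-1) (_.[0]) l0 p0 => l S P l0 P0.
  by field; rewrite l0 P0.
rewrite Im_sum big_seq; apply: sumr_ge0 => z /rsIm Iz.
by rewrite ImV divr_ge0 ?exprn_ge0 ?nrm_ge0 // oppr_ge0 ltW.
Qed.

(** Every root lies in the closed lower half plane, hence is no farther from 0 than from [i]. *)
Lemma nrm_upper_mono (q : {poly C}) :
  (forall t, 0 < Im t -> q.[t] != 0) -> nrm q.[0] <= nrm q.['i%C].
Proof.
move=> qN0; have [rs Eq] := closed_field_poly_normal q.
have lc0 : lead_coef q != 0.
  have : q.['i%C] != 0 by rewrite qN0 //= ltr01.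
  by apply: contraNneq => lc0; rewrite Eq lc0 scale0r horner0.
have rsIm z : z \in rs -> Im z <= 0.
  move=> zrs; rewrite leNgt; apply/negP => /qN0.
  by rewrite Eq hornerZ mulf_eq0 (negPf lc0) -/(root _ _) root_prod_XsubC zrs.
rewrite Eq !hornerZ !nrmM ler_wpM2l ?nrm_ge0 // !horner_prod !nrm_prod.
rewrite big_seq [leRHS]big_seq; apply: ler_prod => z /rsIm Iz; rewrite nrm_ge0 !hornerXsubC /=.
rewrite -ler_sqr ?nnegrE ?nrm_ge0 // !nrm_sqr !(ReD, ImD, ReN, ImN) /=.
by nra.
Qed.

Lemma prod_inv_roots (rs : seq C) : {in rs, forall z, z != 0} ->
  \prod_(z <- rs) ('X - z%:P) =
  (\prod_(z <- rs) ('X - z%:P)).[0] *: \prod_(z <- rs) (1 - z^-1 *: 'X).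
Proof.
elim: rs => [|y rs IH] rs0; first by rewrite !big_nil hornerC scale1r.
have y0 : y != 0 by rewrite rs0 ?mem_head.
rewrite !big_cons hornerM {1}IH; last first.
  by move=> z zrs; rewrite rs0 // inE zrs orbT.
rewrite hornerXsubC sub0r -scalerAr -!mul_polyC polyCM polyCN.
have : y%:P * y^-1%:P = 1 :> {poly C} by rewrite -polyCM divff.
move: (\prod_(z <- rs) ('X - z%:P)).[0] (\prod_(z <- rs) (1 - z^-1 *: 'X)) => a b.
move: a%:P (y%:P) (y^-1%:P) => c d e de.
have -> : 'X - d = - d * (1 - e * 'X) by rewrite mulrBr mulr1 mulNr mulrA de mul1r opprK addrC.
ring.
Qed.

(** Newton's identities up to degree 2. *)
Lemma coef_prod_1subZX (ys : seq C) :
  let P := \prod_(y <- ys) (1 - y *: 'X) in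
  [/\ P`_0 = 1, P`_1 = - \sum_(y <- ys) y &
      P`_2 *+ 2 = (\sum_(y <- ys) y) ^+ 2 - \sum_(y <- ys) y ^+ 2].
Proof.
elim: ys => [|y ys /= [IH0 IH1 IH2]] /=.
  by rewrite !big_nil !coefC /= expr0n /= subrr oppr0 mul0rn.
rewrite !big_cons mulrBl mul1r -scalerAl !(coefB, coefZ, coefXM) /= IH0 IH1.
split; first by rewrite mulr0 subr0.
  by rewrite mulr1 opprD addrC.
by rewrite mulrnBl IH2; set S := \sum_(_ <- _) _; set T := \sum_(_ <- _) _; ring.
Qed.

Lemma nrm_1sub_exp (u : C) : nrm (1 - u) ^+ 2 <= expR (- (Re u *+ 2) + nrm u ^+ 2).
Proof.
apply: le_trans (expR_ge1Dx _); rewrite !nrm_sqr !(ReD, ImD, ReN, ImN) /=.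
by rewrite le_eqVlt; apply/orP; left; apply/eqP; ring.
Qed.

(** Here [A / d] bounds the coefficients of degree at most 2 of [q / q(0)]; the exponent bounds the
    sums of [y] and of [|y|^2] over the inverse roots, weighted by [r] and [r^2]. *)
Definition szasz_const (d A r : R) : R :=
  A * expR (r * (A / d) + r ^+ 2 * (3 * (A / d) ^+ 2 + 2 * (A / d))).

(* The roots [z] lie in the closed lower half plane, so the [Im z^-1 >= 0] do
   not cancel: [sum Im z^-1], and with it [sum |z^-1|^2], is controlled by the
   first two Newton sums, i.e. by the coefficients of degree at most 2. *)
Lemma szasz (q : {poly C}) (d A r : R) (t : C) : 0 < d ->
  (forall t, 0 < Im t -> q.[t] != 0) ->
  d <= nrm q`_0 -> (forall i, (i < 3)%N -> nrm q`_i <= A) ->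
  nrm t <= r -> nrm q.[t] <= szasz_const d A r.
Proof.
move=> d0 qN0 dq qA tr.
have r0 : 0 <= r := le_trans (nrm_ge0 _) tr.
have b0 : q.[0] != 0 by rewrite -nrm_gt0 horner_coef0 (lt_le_trans d0).
have A0 : 0 <= A := le_trans (nrm_ge0 _) (qA 0%N isT).
have [rs Eq] := closed_field_poly_normal q.
have lc0 : lead_coef q != 0.
  by apply: contraTneq b0 => lc0; rewrite Eq lc0 scale0r horner0 eqxx.
have rsIm z : z \in rs -> Im z <= 0.
  move=> zrs; rewrite leNgt; apply/negP => /qN0.
  by rewrite Eq hornerZ mulf_eq0 (negPf lc0) -/(root _ _) root_prod_XsubC zrs.
have rs0 : {in rs, forall z, z != 0}.
  move=> z zrs; apply: contraNneq b0 => z0; rewrite Eq hornerZ mulf_eq0.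
  by move: zrs; rewrite -root_prod_XsubC z0 => /eqP ->; rewrite eqxx orbT.
pose ys := [seq z^-1 | z <- rs].
pose P := \prod_(y <- ys) (1 - y *: 'X).
have EqP : q = q`_0 *: P.
  rewrite -horner_coef0 {1 2}Eq hornerZ -scalerA; congr (_ *: _).
  by rewrite {1}prod_inv_roots // /P big_map.
have ysIm y : y \in ys -> 0 <= Im y.
  case/mapP => z zrs ->; rewrite ImV divr_ge0 ?exprn_ge0 ?nrm_ge0 //.
  by rewrite oppr_ge0 rsIm.
have [P0 P1 P2] := coef_prod_1subZX ys; rewrite -/P in P0 P1 P2.
set s1 := \sum_(y <- ys) y in P1 P2; set s2 := \sum_(y <- ys) _ in P2.
set B := A / d.
have B0 : 0 <= B by rewrite divr_ge0 // ltW.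
have PB i : (i < 3)%N -> nrm P`_i <= B.
  move=> i3; rewrite ler_pdivlMr //; apply: le_trans (qA i i3).
  by rewrite [in leRHS]EqP coefZ nrmM mulrC ler_wpM2r ?nrm_ge0.
have s1B : nrm s1 <= B by rewrite -nrmN -P1 PB.
have s2B : nrm s2 <= B ^+ 2 + 2 * B.
  have -> : s2 = s1 ^+ 2 - P`_2 *+ 2 by rewrite P2; ring.
  rewrite (le_trans (nrmB _ _)) // lerD //.
    by rewrite nrmX lerXn2r ?nnegrE ?nrm_ge0.
  by rewrite mulr2n mulr_natl mulr2n (le_trans (nrmD _ _)) // lerD // PB.
have sImB : \sum_(y <- ys) Im y <= B.
  by rewrite -Im_sum (le_trans (ler_norm _)) // (le_trans (Im_le_nrm _)).
(* For nonnegative terms, the sum of the squares is at most the square of the sum. *)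
have sIm2 : \sum_(y <- ys) Im y ^+ 2 <= B ^+ 2.
  apply: (@le_trans _ _ ((\sum_(y <- ys) Im y) ^+ 2)); last first.
    rewrite lerXn2r ?nnegrE // big_seq; exact: sumr_ge0.
  elim: (ys) ysIm => [|y s IH] sIm; first by rewrite !big_nil expr0n.
  rewrite !big_cons; have := IH (fun z zs => sIm z (@mem_behead _ (y :: s) z zs)).
  have : 0 <= Im y by rewrite sIm ?mem_head.
  have : 0 <= \sum_(y <- s) Im y.
    by rewrite big_seq; apply: sumr_ge0 => z zs; rewrite sIm // inE zs orbT.
  move: (\sum_(_ <- _) Im _) (\sum_(_ <- _) Im _ ^+ 2) => a b; nra.
(* From [|y|^2 = Re (y^2) + 2 (Im y)^2]. *)
have sn2 : \sum_(y <- ys) nrm y ^+ 2 <= 3 * B ^+ 2 + 2 * B.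
  have -> : \sum_(y <- ys) nrm y ^+ 2 = Re s2 + 2 * \sum_(y <- ys) Im y ^+ 2.
    rewrite /s2 Re_sum mulr_sumr -big_split /=; apply: eq_bigr => y _.
    rewrite nrm_sqr expr2 ReM; ring.
  have := le_trans (ler_norm _) (le_trans (Re_le_nrm s2) s2B); nra.
(* The linear terms are added before moduli are taken, so that only [|s1|] enters, and not the sum
   of the [|y|]. *)
have Pt : nrm P.[t] ^+ 2 <= expR (2 * r * B + r ^+ 2 * (3 * B ^+ 2 + 2 * B)).
  apply: (@le_trans _ _ (expR (\sum_(y <- ys) (- (Re (y * t) *+ 2) + nrm (y * t) ^+ 2)))).
    rewrite expR_sum horner_prod nrm_prod -prodrXl; apply: ler_prod => y _.
    rewrite exprn_ge0 ?nrm_ge0 //= hornerD hornerN hornerZ hornerX hornerC.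
    exact: nrm_1sub_exp.
  rewrite ler_expR big_split /= lerD //.
    have -> : \sum_(y <- ys) - (Re (y * t) *+ 2) = 2 * Re (- (s1 * t)).
      by rewrite sumrN sumrMnl ReN mulr_suml Re_sum mulrN mulr_natl.
    rewrite -mulrA ler_wpM2l // (le_trans (ler_norm _)) // (le_trans (Re_le_nrm _)) //
      nrmN nrmM mulrC.
    by rewrite ler_pM ?nrm_ge0.
  have -> : \sum_(y <- ys) nrm (y * t) ^+ 2 = (\sum_(y <- ys) nrm y ^+ 2) * nrm t ^+ 2.
    by rewrite mulr_suml; apply: eq_bigr => y _; rewrite nrmM exprMn.
  rewrite mulrC ler_pM ?exprn_ge0 ?nrm_ge0 ?lerXn2r ?nnegrE ?nrm_ge0 //.
  by apply: sumr_ge0 => y _; rewrite exprn_ge0 // nrm_ge0.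
rewrite EqP hornerZ nrmM /szasz_const -/B ler_pM ?nrm_ge0 ?qA //.
rewrite -ler_sqr ?nnegrE ?nrm_ge0 ?expR_ge0 // (le_trans Pt) // -expRM_natl ler_expR.
have : 0 <= r ^+ 2 * (3 * B ^+ 2 + 2 * B) by rewrite mulr_ge0 ?exprn_ge0 // addr_ge0 //
  mulr_ge0 // exprn_ge0.
nra.
Qed.

Lemma szasz_coef (q : {poly C}) (d A r : R) k : 0 < d -> 0 <= r ->
  (forall t, 0 < Im t -> q.[t] != 0) ->
  d <= nrm q`_0 -> (forall i, (i < 3)%N -> nrm q`_i <= A) ->
  nrm q`_k * r ^+ k <= szasz_const d A r.
Proof.
move=> d0 r0 qN0 dq qA; apply: cauchy_poly => // t tr.
by apply: szasz => //; rewrite tr.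
Qed.

End UnivariateStable.
(** * Hurwitz' theorem in several variables *)

Section Line.
Variables (R : realType) (m : nat).
Local Notation C := R[i].
Implicit Types (p q : {mpoly C[m]}) (z v : 'I_m -> C).

(** The restriction of [p] to the complex line [t |-> z + t v], as a polynomial in [t]. *)
Definition line z v p : {poly C} :=
  mmap (@polyC C) (fun i => (z i)%:P + v i *: 'X) p.

Lemma horner_line z v p t : (line z v p).[t] = p.@[fun i => z i + v i * t].
Proof.
rewrite /line /mmap mevalE horner_sum; apply: eq_bigr => k _.
rewrite hornerM hornerC /mmap1 horner_prod; congr (_ * _).
by apply: eq_bigr => i _; rewrite horner_exp hornerD hornerC hornerZ hornerX.
Qed.

Lemma horner_line0 z v p : (line z v p).[0] = p.@[z].
Proof. by rewrite horner_line; apply: meval_eq => i; rewrite mulr0 addr0. Qed.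

Lemma coef_line0 v p d : (line (fun=> 0) v p)`_d =
  \sum_(k <- msupp p | mdeg k == d) p@_k * \prod_i v i ^+ k i.
Proof.
rewrite /line /mmap coef_sum [RHS]big_mkcond /=; apply: eq_bigr => k _.
rewrite coefCM /mmap1.
rewrite (eq_bigr (fun i => v i ^+ k i *: 'X^(k i))); last by move=> i _;
  rewrite polyC0 add0r exprZn.
rewrite scaler_prod coefZ prodrXr -mdegE coefXn eq_sym.
by case: eqP; rewrite ?mulr1 ?mulr0.
Qed.

End Line.

Section LineDeriv.
Variables (R : realType) (m : nat).
Local Notation C := R[i].

(** The identity holds for constants and variables and passes to sums and, by Leibniz' rule, to
    products. *)
Lemma deriv_line z (j : 'I_m) (p : {mpoly C[m]}) :
  (line z (fun i => (i == j)%:R) p)^`()%R = line z (fun i => (i == j)%:R) p^`M(j).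
Proof.
set v := fun i => _; pose L := mmap (@polyC C) (fun i => (z i)%:P + v i *: 'X).
pose Q p := deriv (L p) = L p^`M(j).
have QD p1 p2 : Q p1 -> Q p2 -> Q (p1 + p2).
  by rewrite /Q => E1 E2; rewrite /L mmapD derivD mderivD mmapD -/L E1 E2.
have QM p1 p2 : Q p1 -> Q p2 -> Q (p1 * p2).
  rewrite /Q => E1 E2; rewrite {1}/L rmorphM derivM -/L E1 E2 mderivM.
  by rewrite /L rmorphD !rmorphM.
have QC c : Q c%:MP by rewrite /Q /L mmapC derivC mderivC mmap0.
have QX i : Q 'X_i.
  rewrite /Q /L mmapX mmap1U derivD derivC add0r derivZ derivX mderivX mnm1E /v.
  rewrite alg_polyC; case: eqP => [->|_]; last by rewrite scale0r mmap0.
  have -> : (U_(j) - U_(j))%MM = 0%MM :> 'X_{1..m} by apply/mnmP => l; rewrite mnmBE subnn mnm0E.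
  by rewrite !scale1r mpolyX0 -mpolyC1 mmapC.
have Q0 : Q 0 by rewrite -mpolyC0; exact: QC.
have Q1 : Q 1 by rewrite -mpolyC1; exact: QC.
rewrite -/(Q p) (mpolyE p); apply: (big_ind Q Q0 QD) => k _.
rewrite -mul_mpolyC; apply: (QM _ _ (QC _)); rewrite mpolyXE_id.
apply: (big_ind Q Q1 QM) => i _.
elim: (k i) => [|a IH]; first by rewrite expr0.
by rewrite exprS; exact: (QM _ _ (QX i) IH).
Qed.

End LineDeriv.

(** * Locally uniform convergence of polynomials *)

Section Lcv.
Variables (R : realType) (m : nat).
Local Notation C := R[i].
Implicit Types (p q : {mpoly C[m]}) (s : nat -> {mpoly C[m]}).

(** Uniform convergence on all closed polydiscs, in terms of real bounds only. *)
Definition loc_cvg s q := forall r e : R, 0 < e -> \forall k \near \oo,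
  forall z : 'I_m -> C, (forall i, nrm (z i) <= r) -> nrm ((s k).@[z] - q.@[z]) <= e.

Lemma meval_bound q (r : R) : exists2 B : R, 0 < B &
  forall z : 'I_m -> C, (forall i, nrm (z i) <= r) -> nrm q.@[z] <= B.
Proof.
pose B := \sum_(k <- msupp q) nrm q@_k * r ^+ mdeg k.
exists (`|B| + 1) => [|z zr]; first by rewrite ltr_wpDl.
apply: (@le_trans _ _ B); last by rewrite (le_trans (ler_norm _)) // lerDl.
rewrite mevalE (le_trans (nrm_sum _ _ _)) //; apply: ler_sum => k _.
rewrite nrmM ler_wpM2l ?nrm_ge0 // mdegE -prodrXr nrm_prod; apply: ler_prod => i _.
by rewrite nrm_ge0 nrmX lerXn2r // nnegrE ?nrm_ge0 // (le_trans (nrm_ge0 (z i))).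
Qed.

Lemma loc_cvg_cst q : loc_cvg (fun=> q) q.
Proof. by move=> r e e0; near=> k => z _; rewrite subrr nrm0 ltW. Unshelve. all: by end_near. Qed.

Lemma loc_cvgD s1 s2 q1 q2 : loc_cvg s1 q1 -> loc_cvg s2 q2 -> loc_cvg (fun k =>
  s1 k + s2 k) (q1 + q2).
Proof.
move=> c1 c2 r e e0; have e20 : 0 < e / 2 by rewrite divr_gt0.
apply: filterS2 (c1 r _ e20) (c2 r _ e20) => k h1 h2 z zr.
rewrite !mevalD opprD addrACA (le_trans (nrmD _ _)) // [leRHS]splitr lerD //.
  exact: h1.
exact: h2.
Qed.

Lemma loc_cvgZ (a : nat -> C) (b : C) q :
  (forall e : R, 0 < e -> \forall k \near \oo, nrm (a k - b) <= e) ->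
  loc_cvg (fun k => a k *: q) (b *: q).
Proof.
move=> ab r e e0; have [B B0 qB] := meval_bound q r.
have := ab (e / B) (divr_gt0 e0 B0); apply: filterS => k abk z zr.
rewrite !mevalZ -mulrBl nrmM -[e](divfK (lt0r_neq0 B0)).
by rewrite ler_pM ?nrm_ge0 // qB.
Qed.

Lemma loc_cvg_sum I (l : seq I) (s : I -> nat -> {mpoly C[m]}) (q : I -> {mpoly C[m]}) :
  (forall i, loc_cvg (s i) (q i)) ->
  loc_cvg (fun k => \sum_(i <- l) s i k) (\sum_(i <- l) q i).
Proof.
move=> c; elim: l => [|i l IH].
  by rewrite big_nil; under eq_fun do rewrite big_nil; exact: loc_cvg_cst.
by rewrite big_cons; under eq_fun do rewrite big_cons; exact: loc_cvgD.
Qed.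

Lemma loc_cvg_eq s s' q : s =1 s' -> loc_cvg s q -> loc_cvg s' q.
Proof. by move=> /funext ->. Qed.

End Lcv.

(** * Cauchy's estimates in several variables *)

Section Cauchy.
Variables (R : realType).
Local Notation C := R[i].

(** As in one variable, with an average over a grid of [N^m] points of the torus: a monomial other
    than [k] differs from it in some coordinate, and the sum over that coordinate vanishes. *)
Lemma cauchy_mpoly m (p : {mpoly C[m]}) (r M : R) k : 0 <= r ->
  (forall z, (forall i, nrm (z i) = r) -> nrm p.@[z] <= M) ->
  nrm p@_k * r ^+ mdeg k <= M.
Proof.
move=> r0 pM; pose N := (msize p + mdeg k).+1.
have le_mdeg (k' : 'X_{1..m}) i : (k' i <= mdeg k')%N by rewrite mdegE (bigD1 i) ?leq_addr.
have [w wN] := @prim_root_exists R N isT.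
have nw := prim_root_nrm wN.
pose pt (f : {ffun 'I_m -> 'I_N}) i := r%:C%C * w ^+ f i.
have npt f i : nrm (pt f i) = r.
  by rewrite nrmM nrmX nw expr1n mulr1 nrm_real ger0_norm.
have E : \sum_(f : {ffun 'I_m -> 'I_N}) p.@[pt f] * \prod_i w ^+ (f i * (N - k i)) =
    (N ^ m)%:R * (p@_k * r%:C%C ^+ mdeg k).
  transitivity (\sum_(k' <- msupp p) p@_k' * r%:C%C ^+ mdeg k' *
      \prod_i \sum_(j < N) w ^+ (j * (k' i + (N - k i)))).
    under [RHS]eq_bigr do rewrite bigA_distr_bigA mulr_sumr.
    rewrite exchange_big /=; apply: eq_bigr => f _.
    rewrite mevalE mulr_suml; apply: eq_bigr => k' _.
    rewrite -!mulrA; congr (_ * _); rewrite mdegE -prodrXr -!big_split /=.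
    by apply: eq_bigr => i _; rewrite exprMn -exprM mulnDr exprD mulrA.
  have kE k' : k' \in msupp p ->
      \prod_i \sum_(j < N) w ^+ (j * (k' i + (N - k i))) = (N ^ m)%:R *+ (k' == k) :> C.
    move=> /msize_mdeg_lt k'p; case: eqP => [->|/eqP k'k].
      rewrite (eq_bigr (fun _ => N%:R)); first by rewrite prodr_const card_ord natrX.
      move=> i _; rewrite (sum_prim_root _ wN) subnKC ?dvdnn //.
      by rewrite (leq_trans (le_mdeg k i)) // /N; lia.
    have [i ki] : exists i, k' i != k i.
      apply: contrapT => h; move/eqP: k'k; apply; apply/mnmP => i.
      by apply: contrapT => /eqP ki; apply: h; exists i.
    rewrite (bigD1 i) //= (sum_prim_root _ wN) ifF ?mul0r //.
    apply/negP => /dvdnP[q Eq]; have := le_mdeg k' i; have := le_mdeg k i.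
    rewrite /N in Eq *; case: q Eq => [|[|q]]; rewrite ?mul0n ?mul1n ?mulSn; lia.
  rewrite big_seq (eq_bigr (fun k' =>
    if k' == k then (N ^ m)%:R * (p@_k * r%:C%C ^+ mdeg k) else 0)); last first.
    by move=> k' /kE ->; case: eqP => [->|_]; rewrite ?mulr0 // mulrC.
  rewrite -big_seq -big_mkcond /=; have [kp|kp] := boolP (k \in msupp p).
    by rewrite (big_rem k) //= eqxx big1_seq ?addr0 // => k' /andP[/eqP -> ];
      rewrite mem_rem_uniq ?msupp_uniq // inE eqxx.
  by rewrite (memN_msupp_eq0 kp) mul0r mulr0 big1_seq.
have : nrm ((N ^ m)%:R * (p@_k * r%:C%C ^+ mdeg k)) <= (N ^ m)%:R * M.
  rewrite -E (le_trans (nrm_sum _ _ _)) // mulr_natl.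
  have -> : (N ^ m)%N = #|{ffun 'I_m -> 'I_N}| by rewrite card_ffun !card_ord.
  rewrite -sumr_const.
  apply: ler_sum => f _; rewrite nrmM nrm_prod [X in _ * X]big1 ?mulr1.
    exact/pM/npt.
  by move=> i _; rewrite nrmX nw expr1n.
rewrite !nrmM nrmX nrm_real (ger0_norm r0) nrm_nat ler_pM2l // ltr0n expn_gt0 //.
Qed.

(** If [p] vanished everywhere, Cauchy's estimate with the bound 0 would kill all its
    coefficients. *)
Lemma meval_neq0 m (p : {mpoly C[m]}) : p != 0 -> exists z, p.@[z] != 0.
Proof.
move=> p0; apply: contrapT => h; case/negP: p0; apply/eqP/mpolyP => k.
rewrite mcoeff0; apply/eqP; rewrite -nrm_eq0 eq_le nrm_ge0 andbT.
have := @cauchy_mpoly m p 1 0 k ler01; rewrite expr1n mulr1; apply=> z _.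
have -> : p.@[z] = 0 by apply: contrapT => /eqP z0; apply: h; exists z.
by rewrite nrm0.
Qed.

End Cauchy.

(** * Zeros of limits of stable polynomials *)

Section Hurwitz.
Variables (R : realType).
Local Notation C := R[i].

(** The radius avoids the moduli of the finitely many roots; then [|t - z| >= |r - |z||] bounds each
    linear factor from below. *)
Lemma circle_min (p : {poly C}) : p != 0 -> forall r0 : R, 0 < r0 ->
  exists r d : R, [/\ 0 < r, r <= r0, 0 < d & forall t, nrm t = r -> d <= nrm p.[t]].
Proof.
move=> p0 r0 r0_gt0; have [rs Ep] := closed_field_poly_normal p.
have [r [r_gt0 rr0 rrs]] : exists r, [/\ 0 < r, r <= r0 & all (fun z => nrm z != r) rs].
  elim: {Ep} rs r0 r0_gt0 => [|z rs IH] r0 r0_gt0; first by exists r0.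
  have [z0|z0] := eqVneq (nrm z) 0.
    have [r [r_gt0 rr0 rrs]] := IH _ r0_gt0; exists r; split=> //=.
    by rewrite rrs z0 andbT lt_eqF.
  have zp : 0 < nrm z by rewrite lt_def z0 nrm_ge0.
  have [|r [r_gt0 rr rrs]] := IH (Num.min r0 (nrm z / 2)).
    by rewrite lt_min r0_gt0 divr_gt0.
  exists r; move: rr; rewrite le_min => /andP[rr0 rz]; split=> //=.
  by rewrite rrs andbT gt_eqF // (le_lt_trans rz) // ltr_pdivrMr // ltr_pMr // ltr1n.
exists r, (nrm (lead_coef p) * \prod_(z <- rs) `|r - nrm z|); split=> //.
  rewrite mulr_gt0 ?nrm_gt0 ?lead_coef_eq0 // big_seq prodr_gt0 // => z zrs.
  by rewrite normr_gt0 subr_eq0 eq_sym (allP rrs).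
move=> t tr; rewrite Ep hornerZ nrmM -Ep ler_wpM2l ?nrm_ge0 // horner_prod nrm_prod.
apply: ler_prod => z _; rewrite normr_ge0 hornerXsubC /= -tr ler_norml nrm_lerB andbT.
by rewrite lerNl opprB nrm_distC nrm_lerB.
Qed.

(** If [q] is not 0 but vanishes at [z], restrict to the line from [z] to a point [y] where [q] does
    not vanish. On a small circle about [z] the limit is bounded below, so a close [s k] is as well.
    Having no zero in the disc, [s k] is then bounded below at [z], where it should be small. *)
Lemma hurwitz m (s : nat -> {mpoly C[m]}) (q : {mpoly C[m]}) :
  (forall k, stable (s k) \/ s k = 0) -> loc_cvg s q -> stable q \/ q = 0.
Proof.
move=> sS sq; have [->|q0] := eqVneq q 0; [by right|left].
move=> z zH; apply/eqP => qz0.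
have [y qy] := meval_neq0 q0.
pose v i := y i - z i; pose g := line z v q.
have g0 : g != 0.
  apply: contra_neq qy => g0; have := horner_line z v q 1.
  rewrite -/g g0 horner0 => ->; apply: meval_eq => i.
  by rewrite mulr1 /v addrC subrK.
(* The radius is [1 / (2 M)], where [M] bounds all [|v i| / Im (z i)], so that [v i * t] cannot push
   [z i] out of the half plane. *)
have [r0 r0_gt0 r0H] : exists2 r0 : R, 0 < r0 &
    forall t i, nrm t <= r0 -> 0 < Im (z i + v i * t).
  pose M := \big[Num.max/1]_i (nrm (v i) / Im (z i)).
  have M0 : 0 < M by rewrite (lt_le_trans ltr01) // bigmax_ge_id.
  exists (M *+ 2)^-1 => [|t i tM]; first by rewrite invr_gt0 pmulrn_lgt0.
  have vM : nrm (v i) <= M * Im (z i).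
    by rewrite -ler_pdivrMr; [exact: le_bigmax|exact: zH].
  have : nrm (v i * t) < Im (z i).
    rewrite nrmM (@le_lt_trans _ _ (M * Im (z i) * (M *+ 2)^-1)) ?ler_pM ?nrm_ge0 //.
    rewrite mulrAC -mulr_natr invfM mulrA divff ?lt0r_neq0 // mul1r gtr_pMl; last exact: zH.
    by rewrite invf_lt1 ?ltr1n.
  rewrite ImD; have := Im_le_nrm (v i * t); rewrite ler_norml => /andP[h _] h2.
  by rewrite -ltrBlDl sub0r (lt_le_trans _ h) // ltrN2.
have [r [d [r_gt0 rr0 d_gt0 gd]]] := circle_min g0 r0_gt0.
pose B := \big[Num.max/0]_i (nrm (z i) + nrm (v i) * r).
have Bz t : nrm t <= r -> forall i, nrm (z i + v i * t) <= B.
  move=> tr i; rewrite (le_trans (nrmD _ _)) // nrmM.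
  apply: le_trans (le_bigmax _ _ i); rewrite lerD2l ler_wpM2l ?nrm_ge0 //.
(* With precision [d / 3], [s k] is at least [2 d / 3] on the circle and at most [d / 3] at the
   centre. *)
have := sq B (d / 3) (divr_gt0 d_gt0 (ltr0n _ 3)).
move=> [k _ /(_ k (leqnn k)) sk].
have sk_t t : nrm t <= r -> nrm ((line z v (s k)).[t] - g.[t]) <= d / 3.
  by move=> tr; rewrite !horner_line; exact/sk/Bz.
have sk_r t : nrm t = r -> d - d / 3 <= nrm (line z v (s k)).[t].
  move=> tr; have := sk_t t; rewrite tr lexx => /(_ isT).
  have := gd _ tr; have := nrm_lerB g.[t] (line z v (s k)).[t].
  rewrite [nrm (_ - (line _ _ _).[_])]nrm_distC; lra.
have sk0 : stable (s k).
  case: (sS k) => // sk0; have := sk_r r%:C%C.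
  rewrite nrm_real (ger0_norm (ltW r_gt0)) => /(_ (erefl _)).
  rewrite sk0 /line mmap0 horner0 nrm0; lra.
have sN0 t : nrm t <= r -> (line z v (s k)).[t] != 0.
  by move=> tr; rewrite horner_line; apply: sk0 => i; apply: r0H; apply: le_trans rr0.
have := disc_min r_gt0 sN0 sk_r.
have := sk_t 0; rewrite nrm0 (ltW r_gt0) => /(_ isT).
rewrite [g.[0]]horner_line0 qz0 subr0; lra.
Qed.

End Hurwitz.
(** * Operators preserving stability *)

Section MonMap.
Variables (R : realType) (m m' : nat).
Local Notation C := R[i].
Variables (phi : 'X_{1..m} -> C) (psi : 'X_{1..m} -> 'X_{1..m'}).

(** The linear map with [X^k |-> phi k X^(psi k)]: a common form for specializations, contractions,
    homogeneous parts and changes of the set of variables. *)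
Definition monmap (p : {mpoly C[m]}) : {mpoly C[m']} :=
  \sum_(k <- msupp p) (p@_k * phi k) *: 'X_[psi k].

Lemma monmapwE d p : (msize p <= d)%N ->
  monmap p = \sum_(k : 'X_{1..m < d}) (p@_k * phi k) *: 'X_[psi k].
Proof.
move=> le_pd; set I : subFinType _ := 'X_{1..m < d}.
rewrite /monmap (big_mksub I) ?msupp_uniq //=; first last.
  by move=> x /msize_mdeg_lt /leq_trans; apply.
rewrite big_rmcond //= => j /memN_msupp_eq0 ->.
by rewrite mul0r scale0r.
Qed.

Fact monmap_is_linear : linear monmap.
Proof.
move=> a p q /=; pose d := maxn (msize (a *: p + q)) (maxn (msize p) (msize q)).
rewrite !(@monmapwE d) ?leq_max ?leqnn ?orbT // scaler_sumr -big_split /=.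
apply: eq_bigr => k _; rewrite mcoeffD mcoeffZ mulrDl scalerDl.
by rewrite -mulrA scalerA.
Qed.

HB.instance Definition _ :=
  GRing.isLinear.Build C {mpoly C[m]} {mpoly C[m']} _ monmap monmap_is_linear.

Lemma monmapX k : monmap 'X_[k] = phi k *: 'X_[psi k].
Proof. by rewrite /monmap msuppX big_seq1 mcoeffX eqxx mul1r. Qed.

Lemma monmap_sum I (s : seq I) (F : I -> {mpoly C[m]}) :
  monmap (\sum_(i <- s) F i) = \sum_(i <- s) monmap (F i).
Proof. exact: linear_sum. Qed.

Lemma monmapZ a p : monmap (a *: p) = a *: monmap p.
Proof. exact: linearZ. Qed.

End MonMap.

Section MonMapTheory.
Variables (R : realType).
Local Notation C := R[i].

Lemma meval_monmap m m' (phi : 'X_{1..m} -> C) (psi : 'X_{1..m} -> 'X_{1..m'}) p z :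
  (monmap phi psi p).@[z] = \sum_(k <- msupp p) p@_k * phi k * \prod_i z i ^+ psi k i.
Proof.
by rewrite /monmap raddf_sum /=; apply: eq_bigr => k _; rewrite mevalZ mevalX.
Qed.

Lemma eq_monmap m m' (phi phi' : 'X_{1..m} -> C) (psi psi' : 'X_{1..m} -> 'X_{1..m'}) p :
  phi =1 phi' -> psi =1 psi' -> monmap phi psi p = monmap phi' psi' p.
Proof. by move=> e1 e2; apply: eq_bigr => k _; rewrite e1 e2. Qed.

Lemma monmap_comp m1 m2 m3 (phi : 'X_{1..m1} -> C) (psi : 'X_{1..m1} -> 'X_{1..m2})
    (phi' : 'X_{1..m2} -> C) (psi' : 'X_{1..m2} -> 'X_{1..m3}) p :
  monmap phi' psi' (monmap phi psi p) =
  monmap (fun k => phi k * phi' (psi k)) (fun k => psi' (psi k)) p.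
Proof.
rewrite {2}/monmap linear_sum; apply: eq_bigr => k _.
by rewrite linearZ /= monmapX scalerA mulrA.
Qed.

Lemma loc_cvg_monmap m m' (phis : nat -> 'X_{1..m} -> C) phi (psi : 'X_{1..m} -> 'X_{1..m'}) p :
  (forall k (e : R), 0 < e -> \forall l \near \oo, nrm (phis l k - phi k) <= e) ->
  loc_cvg (fun l => monmap (phis l) psi p) (monmap phi psi p).
Proof.
move=> h; apply: loc_cvg_sum => k; apply: loc_cvgZ => e e0.
pose a := nrm p@_k + 1; have a0 : 0 < a by rewrite ltr_wpDl ?nrm_ge0.
apply: filterS (h k _ (divr_gt0 e0 a0)) => l hl.
rewrite -mulrBr nrmM -[e](divfK (lt0r_neq0 a0)) mulrC ler_pM ?nrm_ge0 //.
by rewrite /a lerDl.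
Qed.

End MonMapTheory.

(** The quotient of the coefficients of [x^a] in [(1 - x / N)^N] and in [exp(-x)]. *)
Definition ffact_ratio (R : realType) (N a : nat) : R := (N ^_ a)%:R / N%:R ^+ a.

Section StableOps.
Variables (R : realType) (m : nat).
Local Notation C := R[i].
Implicit Types (p q : {mpoly C[m]}).

(** By Hurwitz' theorem, this class is closed under locally uniform limits. *)
Definition stable0 p := stable p \/ p = 0.

Lemma natinv_cvg (w : C) (e : R) : 0 < e ->
  \forall k \near \oo, nrm (k.+1%:R^-1 * w - 0) <= e.
Proof.
move=> e0; pose a := nrm w + 1; have a0 : 0 < a by rewrite ltr_wpDl ?nrm_ge0.
have ea0 : 0 < e / a by rewrite divr_gt0.
apply: filterS (near_infty_natSinv_lt (PosNum ea0)) => k /= /ltW hk.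
rewrite subr0 nrmM nrmV nrm_nat -[e](divfK (lt0r_neq0 a0)).
by rewrite ler_pM ?nrm_ge0 ?invr_ge0 // /a lerDl.
Qed.

Lemma natinvC_gt0 k : exists2 a : R, 0 < a & (k.+1%:R^-1 : C) = a%:C%C.
Proof. by exists k.+1%:R^-1; rewrite ?invr_gt0 // fmorphV rmorph_nat. Qed.

Lemma ImZ (a : R) (x : C) : Im (a%:C%C * x) = a * Im x.
Proof. by case: x => b c /=; rewrite mul0r addr0. Qed.

(** Shifting only the [i]-th coordinate by [t] with [Im t >= 0] stays in the half planes, so the
    univariate statement applies to the restriction. *)
Lemma mlogderiv_Im p (i : 'I_m) z : stable p -> (forall j, H0 (z j)) ->
  Im (p^`M(i).@[z] / p.@[z]) <= 0.
Proof.
move=> pS zH; have := @logderiv_Im R (line z (fun j => (j == i)%:R) p).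
rewrite deriv_line !horner_line0 ImN oppr_ge0; apply=> t t0.
rewrite horner_line; apply: pS => j; rewrite /H0 /= ImD.
have := zH j; rewrite /H0 /=; case: (j == i); rewrite ?mul1r ?mul0r /= ?addr0 //.
by move=> h; rewrite ltr_pwDl.
Qed.

(** For [a > 0], [d_i p - i a p] is [p] times [d_i p / p - i a], whose imaginary part is negative;
    then [a] tends to 0. *)
Lemma stable0_mderiv p i : stable0 p -> stable0 p^`M(i).
Proof.
case=> [pS|->]; last by right; rewrite mderiv0.
apply: (@hurwitz R m (fun k => p^`M(i) + (k.+1%:R^-1 * - 'i%C) *: p)) => [k|].
  left => z zH; have p0 := pS z zH; rewrite mevalD mevalZ.
  have E (a b w : C) : b != 0 -> a + w * b = b * (a / b + w) by move=> b0; field.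
  rewrite E // mulf_neq0 //; have := mlogderiv_Im i pS zH.
  have [a a0 ->] := natinvC_gt0 k; set x := _ / _ => xI.
  apply/eqP => /(congr1 Im); rewrite ImD ImZ /= mulrN1; lra.
rewrite -[q in loc_cvg _ q]addr0 -[X in loc_cvg _ (_ + X)](scale0r p).
by apply: loc_cvgD; [exact: loc_cvg_cst|apply: loc_cvgZ => e e0; exact: natinv_cvg].
Qed.

(** Let [q = d_i p], nonzero. In [q (p / q - c d_j q / q + i a)] the three summands have imaginary
    parts [>= 0], [>= 0] and [> 0]; then [a] tends to 0. *)
Lemma stable0_sub_mderiv2 p (c : R) i j : 0 <= c -> stable0 p ->
  stable0 (p - c%:C%C *: p^`M(i)^`M(j)).
Proof.
move=> c0 [pS|->]; last by right; rewrite !mderiv0 scaler0 subr0.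
case: (stable0_mderiv i (or_introl pS)) => [qS|->]; last first.
  by left; rewrite mderiv0 scaler0 subr0.
set q := p^`M(i) in qS *.
apply: (@hurwitz R m (fun k => p - c%:C%C *: q^`M(j) + (k.+1%:R^-1 * 'i%C) *: q)) => [k|].
  left => z zH; have p0 := pS z zH; have q0 := qS z zH.
  rewrite mevalD mevalB !mevalZ.
  have E (a b d u w : C) : b != 0 -> a - u * d + w * b = b * ((b / a)^-1 - u * (d / b) + w).
    by move=> b0; rewrite invf_div; field.
  rewrite E // mulf_neq0 //; have := mlogderiv_Im i pS zH; have := mlogderiv_Im j qS zH.
  have [a a0 ->] := natinvC_gt0 k; set y := _ / _ => yI; set x := _ / _ => xI.
  apply/eqP => /(congr1 Im); rewrite !(ImD, ImN, ImZ) ImV /=.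
  have : 0 <= - Im x / nrm x ^+ 2 by rewrite divr_ge0 ?oppr_ge0 // exprn_ge0 // nrm_ge0.
  have : c * Im y <= 0 by rewrite mulr_ge0_le0.
  lra.
rewrite -[q in loc_cvg _ q]addr0 -[X in loc_cvg _ (_ + X)](scale0r q).
by apply: loc_cvgD; [exact: loc_cvg_cst|apply: loc_cvgZ => e e0; exact: natinv_cvg].
Qed.

(** Setting [z_i = 0] is the limit of scaling [z_i] by positive numbers tending to 0. *)
Lemma stable0_ev0 p (i : 'I_m) : stable0 p ->
  stable0 (monmap (fun k => (k i == 0%N)%:R) id p).
Proof.
case=> [pS|->]; last by right; rewrite linear0.
apply: (@hurwitz R m (fun l => monmap (fun k => l.+1%:R^-1 ^+ k i) id p)) => [l|].
  left => z zH; pose y j := if j == i then l.+1%:R^-1 * z j else z j.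
  have -> : (monmap (fun k => l.+1%:R^-1 ^+ k i) id p).@[z] = p.@[y].
    rewrite meval_monmap mevalE; apply: eq_bigr => k _.
    rewrite -mulrA; congr (_ * _).
    rewrite (bigD1 i) // [RHS](bigD1 i) //= /y eqxx exprMn mulrA; congr (_ * _).
    by apply: eq_bigr => j /negPf ->.
  apply: pS => j; rewrite /y; case: ifP => // _.
  by have [a a0 ->] := natinvC_gt0 l; rewrite /H0 /= ImZ mulr_gt0 //; exact: zH.
apply: loc_cvg_monmap => k e e0; case: (k i) => [|d].
  by near=> l; rewrite expr0 subrr nrm0 ltW.
apply: filterS (natinv_cvg 1 e0) => l; rewrite mulr1 !subr0 nrmX => h.
apply: le_trans h; rewrite exprS ler_piMr ?nrm_ge0 // exprn_ile1 ?nrm_ge0 //.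
by rewrite nrmV nrm_nat invf_le1 // ler1n.
Unshelve. all: by end_near.
Qed.

(** The value of [exp(-d_i d_j)] at [x_i = x_j = 0] on [x_i^a x_j^b]: it is [(-1)^a a!] if [a = b],
    and 0 otherwise. *)
Definition contract_coef (i j : 'I_m) (k : 'X_{1..m}) : C :=
  if k i == k j then (-1) ^+ k i * (k i)`!%:R else 0.

Definition erase2 (i j : 'I_m) (k : 'X_{1..m}) : 'X_{1..m} :=
  [multinom if (l == i) || (l == j) then 0%N else k l | l < m].

(* At [N], the coefficients of the operator
   [p |-> ((1 - d_i d_j / N) ^ N p)|_(x_i = x_j = 0)]. *)
Lemma ffactS_add n a : (n.+1 ^_ a.+1 = a.+1 * n ^_ a + n ^_ a.+1)%N.
Proof.
rewrite ffactSS ffactnSr; have [an|na] := leqP a n; last by rewrite ffact_small // !muln0.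
by rewrite [(n ^_ a * _)%N]mulnC -mulnDl; congr (_ * _)%N; lia.
Qed.

(** The map is the composition of [N] factors [1 - d_i d_j / N] and two evaluations at 0, all of
    which preserve [stable0]. What remains is to compute this composition on monomials. *)
Lemma stable0_contract_approx p i j N : i != j -> stable0 p ->
  stable0 (monmap (fun k => contract_coef i j k * (ffact_ratio R N (k i))%:C%C) (erase2 i j) p).
Proof.
move=> ij pS; pose c : C := (N%:R^-1 : R)%:C%C.
pose S q := q - c *: q^`M(i)^`M(j).
pose ev q := monmap (fun k => (k j == 0%N)%:R) id (monmap (fun k => (k i == 0%N)%:R) id q).
have evZD a q1 q2 : ev (a *: q1 + q2) = a *: ev q1 + ev q2 by rewrite /ev !linearP.
have SZD a q1 q2 : S (a *: q1 + q2) = a *: S q1 + S q2.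
  by rewrite /S !mderivD !mderivZ scalerBr scalerDr opprD addrACA !scalerA mulrC.
have SnZD n a q1 q2 : iter n S (a *: q1 + q2) = a *: iter n S q1 + iter n S q2.
  by elim: n => //= n ->; rewrite SZD.
have SnS n : stable0 (iter n S p).
  by elim: n => //= n IH; apply: stable0_sub_mderiv2 => //; rewrite invr_ge0.
(* One factor gives the monomial itself and one with both exponents lowered by 1; [ffactS_add]
   combines their contributions. *)
have E n k : ev (iter n S 'X_[k]) =
    (contract_coef i j k * (c ^+ k i * (n ^_ k i)%:R)) *: 'X_[erase2 i j k].
  elim: n k => [|n IH] k.
    rewrite /= /ev monmapX linearZ /= monmapX scalerA /contract_coef.
    case ki: (k i) => [|a]; case kj: (k j) => [|b]; rewrite ?(mulr0, mul0r, scale0r) //=.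
      congr (_ *: 'X_[_]); first by rewrite expr0 fact0 !mulr1.
      by apply/mnmP => l; rewrite mnmE; do 2![case: eqP => [->|_] //=].
  have SX : S 'X_[k] = (- (c * (k i)%:R * (k j)%:R)) *: 'X_[k - U_(i) - U_(j)] + 'X_[k].
    rewrite /S mderivX mderivZ mderivX mnmBE mnm1E (negPf ij) subn0 scaleNr addrC.
    by rewrite -!scalerA.
  rewrite iterSr SX SnZD evZD !IH.
  have -> : erase2 i j (k - U_(i) - U_(j))%MM = erase2 i j k.
    apply/mnmP => l; rewrite !mnmE; case: (eqVneq l i) => //= li; case: (eqVneq l j) => //= lj.
    by rewrite !subn0.
  rewrite scalerA -scalerDl; congr (_ *: _).
  rewrite /contract_coef !mnmE !eqxx (negPf ij) [j == i]eq_sym (negPf ij) !subn0.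
  case ki: (k i) => [|a]; case kj: (k j) => [|b];
    rewrite ?(mulr0, mul0r, oppr0, add0r, ffactn0) //=.
  rewrite !subn1 /= eqSS; case: eqP => [->|_]; last by rewrite !mul0r mulr0 addr0.
  rewrite ffactS_add factS !natrD !natrM !exprS; ring.
suff -> : monmap (fun k => contract_coef i j k * (ffact_ratio R N (k i))%:C%C) (erase2 i j) p =
  ev (iter N S p).
  by do 2!apply: stable0_ev0.
elim/mpolyind: p {pS SnS} => [|a k q _ _ IH].
  have -> : iter N S 0 = 0 by elim: (N) => //= n ->; rewrite /S !mderiv0 scaler0 subr0.
  rewrite linear0.
  by rewrite /ev !linear0.
rewrite SnZD evZD -IH linearP /= monmapX E; congr (_ *: (_ *: _) + _).
by congr (_ * _); rewrite /ffact_ratio fmorph_div rmorphXn /= !rmorph_nat /c fmorphV rmorph_nat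
  exprVn mulrC.
Qed.

Lemma natinvr_cvg0 : (fun N => N%:R^-1) @ \oo --> (0 : R).
Proof.
apply/cvgrPdist_le => e e0.
have := near_infty_natSinv_lt (PosNum e0) => -[K _ hK].
exists K.+1 => // -[//|N] /= KN; rewrite sub0r normrN ger0_norm ?invr_ge0 //.
by rewrite ltW // hK.
Qed.

Lemma ffact_ratio_cvg a : (fun N => ffact_ratio R N a) @ \oo --> (1 : R).
Proof.
elim: a => [|a IH].
  by under eq_fun do rewrite /ffact_ratio ffactn0 expr0 divr1; exact: cvg_cst.
have h : (fun N => ffact_ratio R N a * (1 - a%:R * N%:R^-1)) @ \oo --> (1 * (1 - a%:R * 0) : R).
  apply: cvgM IH _; apply: cvgB; first exact: cvg_cst.
  by apply: cvgMr; exact: natinvr_cvg0.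
rewrite mulr0 subr0 mulr1 in h.
apply: cvg_trans h; apply: near_eq_cvg; near=> N.
have N0 : (0 < N)%N by near: N; exact: nbhs_infty_gt.
have aN : (a <= N)%N by near: N; exact: nbhs_infty_ge.
rewrite /ffact_ratio ffactnSr natrM exprS natrB //; field.
by rewrite pnatr_eq0 -lt0n N0 expf_neq0 // pnatr_eq0 -lt0n.
Unshelve. all: by end_near.
Qed.

Lemma ffact_ratio_ge0 N a : 0 <= ffact_ratio R N a.
Proof. by rewrite /ffact_ratio divr_ge0 // exprn_ge0. Qed.

Lemma ffact_ratio_le1 N a : ffact_ratio R N a <= 1.
Proof.
rewrite /ffact_ratio; have [->|N0] := posnP N.
  case: a => [|a]; first by rewrite ffactn0 expr0 divr1.
  by rewrite ffact_small // mul0r.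
rewrite ler_pdivrMr ?exprn_gt0 ?ltr0n // mul1r -natrX ler_nat.
by elim: a => // a IH; rewrite ffactnSr expnSr leq_mul // leq_subr.
Qed.

Lemma cvg_near_nrm (u : nat -> R) (l e : R) : u @ \oo --> l -> 0 < e ->
  \forall k \near \oo, nrm ((u k)%:C%C - l%:C%C) <= e.
Proof.
move=> /cvgrPdist_le /(_ e) h e0; apply: filterS (h e0) => k hk.
by rewrite -rmorphB nrm_real distrC.
Qed.

(** The limit of the preceding operators as [N] grows, since the ratios tend to 1. *)
Lemma stable0_contract p i j : i != j -> stable0 p ->
  stable0 (monmap (contract_coef i j) (erase2 i j) p).
Proof.
move=> ij pS.
apply: (@hurwitz R m (fun N => monmap (fun k =>
  contract_coef i j k * (ffact_ratio R N (k i))%:C%C) (erase2 i j) p)).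
  by move=> N; exact: stable0_contract_approx.
apply: loc_cvg_monmap => k e e0; set a := contract_coef i j k.
pose b := nrm a + 1; have b0 : 0 < b by rewrite ltr_wpDl ?nrm_ge0.
apply: filterS (cvg_near_nrm (@ffact_ratio_cvg (k i)) (divr_gt0 e0 b0)) => N hN.
rewrite -[X in _ - X]mulr1 -mulrBr nrmM mulrC -[e](divfK (lt0r_neq0 b0)).
by rewrite ler_pM ?nrm_ge0 // /b lerDl.
Qed.

End StableOps.

(** * Multi-indices in two blocks of variables *)

Section Join.
Variables (a b : nat).

Lemma split_lshift (i : 'I_a) : fintype.split (lshift b i) = inl i.
Proof. exact: (unsplitK (inl i)). Qed.

Lemma split_rshift (i : 'I_b) : fintype.split (rshift a i) = inr i.
Proof. exact: (unsplitK (inr i)). Qed.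

Definition mjoin (k1 : 'X_{1..a}) (k2 : 'X_{1..b}) : 'X_{1..a + b} :=
  [multinom match fintype.split j with inl i => k1 i | inr i => k2 i end | j < a + b].

Definition mfst (k : 'X_{1..a + b}) : 'X_{1..a} := [multinom k (lshift b i) | i < a].
Definition msnd (k : 'X_{1..a + b}) : 'X_{1..b} := [multinom k (rshift a i) | i < b].

Lemma mjoinl k1 k2 i : mjoin k1 k2 (lshift b i) = k1 i.
Proof. by rewrite mnmE split_lshift. Qed.

Lemma mjoinr k1 k2 i : mjoin k1 k2 (rshift a i) = k2 i.
Proof. by rewrite mnmE split_rshift. Qed.

Lemma mfst_join k1 k2 : mfst (mjoin k1 k2) = k1.
Proof. by apply/mnmP => i; rewrite mnmE mjoinl. Qed.

Lemma msnd_join k1 k2 : msnd (mjoin k1 k2) = k2.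
Proof. by apply/mnmP => i; rewrite mnmE mjoinr. Qed.

Lemma mjoinK k : mjoin (mfst k) (msnd k) = k.
Proof.
by apply/mnmP => j; rewrite -(splitK j); case: (fintype.split j) => i /=;
  rewrite ?mjoinl ?mjoinr mnmE.
Qed.

Lemma eq_mjoin k k1 k2 : (k == mjoin k1 k2) = (mfst k == k1) && (msnd k == k2).
Proof.
apply/eqP/andP => [->|[/eqP <- /eqP <-]]; last by rewrite mjoinK.
by rewrite mfst_join msnd_join !eqxx.
Qed.

Lemma mdeg_join k1 k2 : mdeg (mjoin k1 k2) = (mdeg k1 + mdeg k2)%N.
Proof.
rewrite !mdegE big_split_ord; congr (_ + _)%N; apply: eq_bigr => i _.
  exact: mjoinl.
exact: mjoinr.
Qed.

Lemma prod_mjoin (A : comRingType) (y : 'I_(a + b) -> A) k1 k2 :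
  \prod_j y j ^+ mjoin k1 k2 j =
  \prod_i y (lshift b i) ^+ k1 i * \prod_i y (rshift a i) ^+ k2 i.
Proof.
rewrite big_split_ord; congr (_ * _); apply: eq_bigr => i _.
  by rewrite mjoinl.
by rewrite mjoinr.
Qed.

Lemma prod_mjoinl (A : comRingType) (y : 'I_(a + b) -> A) k1 :
  \prod_j y j ^+ mjoin k1 0%MM j = \prod_i y (lshift b i) ^+ k1 i.
Proof. by rewrite prod_mjoin [X in _ * X]big1 ?mulr1 // => i _; rewrite mnm0E. Qed.

Lemma prod_mjoinr (A : comRingType) (y : 'I_(a + b) -> A) k2 :
  \prod_j y j ^+ mjoin 0%MM k2 j = \prod_i y (rshift a i) ^+ k2 i.
Proof. by rewrite prod_mjoin [X in X * _]big1 ?mul1r // => i _; rewrite mnm0E. Qed.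

End Join.

(** * Applying [f(-d/dw)] to [p(z, w)] at [w = 0] *)

Section Pairing.
Variables (R : realType) (n : nat).
Local Notation C := R[i].
Local Notation m := (n + (n + n))%N.
(** Three blocks of variables: [u] carries [f], and [z], [w] carry [p]. *)
Let uv i : 'I_m := lshift (n + n) i.
Let zv i : 'I_m := rshift n (lshift n i).
Let wv i : 'I_m := rshift n (rshift n i).

Lemma uv_neq_wv i j : uv i == wv j = false.
Proof. by apply/negP => /eqP/(congr1 val) /= ?; have := ltn_ord i; lia. Qed.

Lemma zv_neq_uv i j : zv i == uv j = false.
Proof. by apply/negP => /eqP/(congr1 val) /= ?; have := ltn_ord j; lia. Qed.

Lemma zv_neq_wv i j : zv i == wv j = false.
Proof. by apply/negP => /eqP/(congr1 val) /= ?; have := ltn_ord i; lia. Qed.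

Definition contract_coefs (l : seq 'I_n) (k : 'X_{1..m}) : C :=
  \prod_(i <- l) contract_coef R (uv i) (wv i) k.

Definition erases (l : seq 'I_n) (k : 'X_{1..m}) : 'X_{1..m} :=
  [multinom if has (fun i => (j == uv i) || (j == wv i)) l then 0%N else k j | j < m].

(** The pairs [(u_i, w_i)] are disjoint, so the contractions of the other pairs leave the exponents
    of [u_i] and [w_i] unchanged. *)
Lemma stable0_contracts l (p : {mpoly C[m]}) : uniq l -> stable0 p ->
  stable0 (monmap (contract_coefs l) (erases l) p).
Proof.
move=> + pS; elim: l => [_|i l IH /= /andP[il ul]].
  rewrite (_ : monmap _ _ p = p) // [RHS]mpolyE; apply: eq_bigr => k _.
  by rewrite /contract_coefs big_nil mulr1; congr (_ *: 'X_[_]); apply/mnmP => j; rewrite mnmE.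
have h : uv i != wv i by rewrite uv_neq_wv.
have := stable0_contract h (IH ul); rewrite monmap_comp.
have nouv : has (fun i0 => (uv i == uv i0) || (uv i == wv i0)) l = false.
  apply/negP => /hasP[j jl]; rewrite uv_neq_wv orbF => /eqP/lshift_inj ij.
  by rewrite ij jl in il.
have nowv : has (fun i0 => (wv i == uv i0) || (wv i == wv i0)) l = false.
  apply/negP => /hasP[j jl]; rewrite eq_sym uv_neq_wv /= => /eqP/rshift_inj/rshift_inj ij.
  by rewrite ij jl in il.
rewrite (@eq_monmap _ _ _ _ (contract_coefs (i :: l)) _ (erases (i :: l))) //.
  move=> k; rewrite /contract_coefs big_cons mulrC; congr (_ * _).
  by rewrite /contract_coef !mnmE nouv nowv.
by move=> k; apply/mnmP => j; rewrite !mnmE /=; case: ifP.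
Qed.

(** The value of [(-d/dw)^al] on [w^al], which is the inverse of the factor in [symbol]. *)
Definition pair_coef (al : 'X_{1..n}) : C := (-1) ^+ mdeg al * (mfactorial al)%:R.

(* [pairing f p] is [f(-d/dw) p(z, w)] at [w = 0]. *)
Definition pairing (f : {mpoly C[n]}) (p : {mpoly C[n + n]}) : {mpoly C[n]} :=
  \sum_(al <- msupp f) f@_al *:
    monmap (fun k => if msnd k == al then pair_coef al else 0) (@mfst n n) p.

(** The product [f(u) p(z, w)] is stable in the three blocks; contracting every [u_i] with [w_i]
    leaves the pairing, a polynomial in [z] alone. *)
Lemma stable0_pairing f p : stable f -> stable p -> stable0 (pairing f p).
Proof.
move=> fS pS.
pose fu := monmap (fun=> 1) (fun k => mjoin k 0%MM) f : {mpoly C[m]}.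
pose pw := monmap (fun=> 1) (fun k => mjoin 0%MM k) p : {mpoly C[m]}.
have GS : stable (fu * pw).
  move=> y yH; rewrite mevalM mulf_neq0 //.
    rewrite meval_monmap; under eq_bigr => k _ do rewrite mulr1 prod_mjoinl.
    by rewrite -(mevalE (fun i => y (uv i)) f); apply: fS => i; exact: yH.
  rewrite meval_monmap; under eq_bigr => k _ do rewrite mulr1 prod_mjoinr.
  by rewrite -(mevalE (fun i => y (rshift n i)) p); apply: pS => i; exact: yH.
have := stable0_contracts (enum_uniq 'I_n) (or_introl GS); set CG := monmap _ _ _.
(* The contracted polynomial does not depend on [u] and [w]; they get the value [i] to keep the
   point in the half planes. *)
pose y z (j : 'I_m) : C :=
  match fintype.split j with
  | inl _ => 'i%C
  | inr j' => match fintype.split j' with inl i => z i | inr _ => 'i%C end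
  end.
have yz z i : y z (zv i) = z i by rewrite /y split_rshift split_lshift.
have CGy z : CG.@[y z] = (pairing f p).@[z].
  have coefE al k : contract_coefs (enum 'I_n) (mjoin al k) =
      if msnd k == al then pair_coef al else 0.
    rewrite /contract_coefs big_enum /=; case: eqP => [kal|/eqP kal].
      rewrite (eq_bigr (fun i => (-1) ^+ al i * (al i)`!%:R)); last first.
        move=> i _; rewrite /contract_coef mjoinl mjoinr.
        by rewrite -kal mnmE eqxx.
      by rewrite big_split /= prodrXr -mdegE /pair_coef /mfactorial natr_prod.
    have [i ki] : exists i, msnd k i != al i.
      apply: contrapT => h; move/eqP: kal; apply; apply/mnmP => i.
      by apply: contrapT => /eqP ki; apply: h; exists i.
    rewrite (bigD1 i) //= /contract_coef mjoinl mjoinr ifF ?mul0r //.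
    by apply: contraNF ki => /eqP ->; rewrite mnmE.
  have eraseE al k : \prod_j y z j ^+ erases (enum 'I_n) (mjoin al k) j = \prod_i z i ^+ mfst k i.
    rewrite big_split_ord /= [X in X * _]big1 ?mul1r => [|i _]; last first.
      rewrite mnmE ifT ?expr0 //; apply/hasP; exists i; rewrite ?mem_enum //.
      by rewrite eqxx.
    rewrite big_split_ord /= [X in _ * X]big1 ?mulr1 => [|i _]; last first.
      rewrite mnmE ifT ?expr0 //; apply/hasP; exists i; rewrite ?mem_enum //.
      by rewrite eqxx orbT.
    apply: eq_bigr => i _; rewrite -/(zv i) yz mnmE ifF; first by rewrite mjoinr mnmE.
    by apply/negP => /hasP[j _]; rewrite zv_neq_uv zv_neq_wv.
  have fpE : fu * pw = \sum_(al <- msupp f) \sum_(k <- msupp p) (f@_al * p@_k) *: 'X_[mjoin al k].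
    rewrite /fu /pw /monmap mulr_suml; apply: eq_bigr => al _.
    rewrite mulr_sumr; apply: eq_bigr => k _.
    rewrite !mulr1 -scalerAl -scalerAr scalerA -mpolyXD; congr (_ *: 'X_[_]).
    by apply/mnmP => j; rewrite !mnmE; case: (fintype.split j) => i; rewrite mnm0E ?addn0.
  rewrite /CG fpE monmap_sum (raddf_sum (meval (y z))) /pairing (raddf_sum (meval z)) /=.
  apply: eq_bigr => al _.
  rewrite monmap_sum (raddf_sum (meval (y z))) mevalZ meval_monmap mulr_sumr; apply: eq_bigr => k _.
  by rewrite monmapZ monmapX /= !mevalZ mevalX eraseE coefE !mulrA.
case=> [CS|C0].
  left => z zH; rewrite -CGy; apply: CS => j; rewrite /y.
  by case: (fintype.split j) => [_|j']; [|case: (fintype.split j') => [i|_]; first exact: zH];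
    rewrite /H0 /= ltr01.
right; apply: contrapT => /eqP/meval_neq0[z].
by rewrite -CGy C0 meval0 eqxx.
Qed.

Lemma mcoeff_pair (c : C) al be (p : {mpoly C[n + n]}) :
  (monmap (fun k => if msnd k == al then c else 0) (@mfst n n) p)@_be = c * p@_(mjoin be al).
Proof.
elim/mpolyind: p => [|b k q _ _ IH]; first by rewrite linear0 !mcoeff0 mulr0.
rewrite linearP /= monmapX !(mcoeffD, mcoeffZ) IH mulrDr !mcoeffX eq_mjoin; congr (_ + _).
by case: eqP => _; case: eqP => _; rewrite ?(mulr0, mul0r, mulr1) // mulrC.
Qed.

End Pairing.

(** * Convergence of coefficients, and the passage from (b) to preservation *)

Section Ccv.
Variables (R : realType).
Local Notation C := R[i].

(** Uniform in the multi-index, with every geometric weight: a form of locally uniform convergence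
    that makes sense for a formal series [c]. *)
Definition coef_cvg m (s : nat -> {mpoly C[m]}) (c : 'X_{1..m} -> C) :=
  forall r e : R, 0 < e -> \forall k \near \oo,
    forall kk, nrm ((s k)@_kk - c kk) * r ^+ mdeg kk <= e.

Lemma sum_halfpow (d : nat) : \sum_(j < d) (2^-1 : R) ^+ j <= 2.
Proof.
suff -> : \sum_(j < d) (2^-1 : R) ^+ j = 2 - 2 * 2^-1 ^+ d.
  by rewrite gerBl mulr_ge0 // exprn_ge0 // invr_ge0.
elim: d => [|d IH]; first by rewrite big_ord0 expr0 mulr1 subrr.
by rewrite big_ord_recr /= IH exprS; field.
Qed.

(** The indices inject into a box, over which the sum is a product of [m] geometric sums, each at
    most 2. *)
Lemma sum_half_mdeg m (s : seq 'X_{1..m}) : uniq s ->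
  \sum_(k <- s) (2^-1 : R) ^+ mdeg k <= 2 ^+ m.
Proof.
move=> us; pose d := (\max_(k <- s) mdeg k).+1.
have sd k i : k \in s -> (k i < d)%N.
  move=> ks; rewrite ltnS; apply: (@leq_trans (mdeg k)); last exact: leq_bigmax_seq.
  by rewrite mdegE (bigD1 i) ?leq_addr.
apply: (@le_trans _ _ (\sum_(f : {ffun 'I_m -> 'I_d}) \prod_i (2^-1 : R) ^+ f i)); last first.
  rewrite -(bigA_distr_bigA (fun _ (j : 'I_d) => (2^-1 : R) ^+ j)) /=.
  rewrite -[m in leRHS]card_ord -prodr_const; apply: ler_prod => i _.
  by rewrite sum_halfpow andbT sumr_ge0 // => j _; rewrite exprn_ge0 // invr_ge0.
pose h (k : 'X_{1..m}) : {ffun 'I_m -> 'I_d} := [ffun i => inord (k i)].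
have hE k : k \in s -> (2^-1 : R) ^+ mdeg k = \prod_i (2^-1) ^+ h k i.
  move=> ks; rewrite mdegE -prodrXr; apply: eq_bigr => i _.
  by rewrite ffunE inordK // sd.
have hI : {in s &, injective h}.
  move=> k k' ks ks' /ffunP hk; apply/mnmP => i; have := hk i; rewrite !ffunE => /(congr1 val).
  by rewrite /= !inordK // sd.
rewrite big_seq (eq_bigr _ hE) -big_seq -(big_map h xpredT (fun f : {ffun 'I_m -> 'I_d} =>
  \prod_i (2^-1 : R) ^+ f i)).
rewrite big_uniq ?map_inj_in_uniq //= [leRHS](bigID (mem (map h s))) /= lerDl sumr_ge0 // => f _.
by rewrite prodr_ge0 // => i _; rewrite exprn_ge0 // invr_ge0.
Qed.

Lemma meval_le_coef m (p : {mpoly C[m]}) (r e : R) z : 0 < r ->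
  (forall k, nrm p@_k * (2 * r) ^+ mdeg k <= e) -> (forall i, nrm (z i) <= r) ->
  nrm p.@[z] <= e * 2 ^+ m.
Proof.
move=> r0 pe zr; rewrite mevalE (le_trans (nrm_sum _ _ _)) //.
have e0 : 0 <= e.
  by apply: le_trans (pe 0%MM); rewrite mulr_ge0 ?nrm_ge0 // exprn_ge0 // mulr_ge0 // ltW.
apply: (@le_trans _ _ (\sum_(k <- msupp p) e * 2^-1 ^+ mdeg k)); last first.
  by rewrite -mulr_sumr ler_wpM2l // sum_half_mdeg // msupp_uniq.
apply: ler_sum => k _; apply: (@le_trans _ _ (nrm p@_k * r ^+ mdeg k)).
  rewrite nrmM ler_wpM2l ?nrm_ge0 // mdegE -prodrXr nrm_prod; apply: ler_prod => i _.
  by rewrite nrm_ge0 nrmX lerXn2r // nnegrE ?nrm_ge0 // ltW.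
by rewrite -ler_pdivrMr ?exprn_gt0 ?invr_gt0 // exprVn invrK -mulrA -exprMn [r * _]mulrC.
Qed.

Lemma loc_cvgZl m (a : C) (s : nat -> {mpoly C[m]}) q : loc_cvg s q -> loc_cvg (fun k =>
  a *: s k) (a *: q).
Proof.
move=> sq r e e0; pose b := nrm a + 1; have b0 : 0 < b by rewrite ltr_wpDl ?nrm_ge0.
apply: filterS (sq r _ (divr_gt0 e0 b0)) => k h z zr.
rewrite !mevalZ -mulrBr nrmM mulrC -[e](divfK (lt0r_neq0 b0)).
by rewrite ler_pM ?nrm_ge0 // ?h // /b lerDl.
Qed.

(** [T f] is the pairing of [f] with the series of [T], hence the limit of the pairings of [f] with
    the stable [s k]; Hurwitz' theorem applies. *)
Lemma stable0_of_coef_cvg n (T : {linear {mpoly C[n]} -> {mpoly C[n]}})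
    (s : nat -> {mpoly C[n + n]}) (f : {mpoly C[n]}) :
  (forall k, stable (s k)) -> coef_cvg s (joint_series (symbol T)) ->
  stable f -> stable0 (T f).
Proof.
move=> sS sc fS; apply: (@hurwitz R n (fun k => pairing f (s k))) => [k|].
  exact: stable0_pairing.
rewrite [f in T f]mpolyE linear_sum; apply: loc_cvg_sum => al; rewrite linearZ /=.
apply: loc_cvgZl => r e e0.
(* As [r1 >= 1], the extra factor of [(2 r1)^|al|] in the weight at [mjoin be al] may be dropped. *)
pose r1 := Num.max r 1; have r10 : 0 < r1 by rewrite lt_max ltr01 orbT.
pose b := (nrm (pair_coef R al) + 1) * 2 ^+ n.
have b0 : 0 < b by rewrite mulr_gt0 ?exprn_gt0 // ltr_wpDl ?nrm_ge0.
apply: filterS (sc (2 * r1) _ (divr_gt0 e0 b0)) => k hk z zr.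
rewrite -mevalB -[e](divfK (lt0r_neq0 b0)) /b mulrA.
apply: (@meval_le_coef _ _ r1) => // [be|i]; last by rewrite (le_trans (zr i)) // le_max lexx.
have pc0 : pair_coef R al != 0.
  rewrite /pair_coef mulf_neq0 ?signr_eq0 // pnatr_eq0 -lt0n prodn_gt0 // => i.
  exact: fact_gt0.
have TE : (T 'X_[al])@_be = pair_coef R al * joint_series (symbol T) (mjoin be al).
  rewrite /joint_series.
  have -> : [multinom (mjoin be al) (rshift n i) | i < n] = al by exact: msnd_join.
  have -> : [multinom (mjoin be al) (lshift n i) | i < n] = be by exact: mfst_join.
  rewrite mcoeffZ mulrA -[LHS]mul1r; congr (_ * _).
  move: pc0; rewrite /pair_coef mulf_eq0 negb_or => /andP[s0 f0].
  by rewrite mulrACA -expr2 sqrr_sign mul1r divff.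
rewrite mcoeffB mcoeff_pair TE -mulrBr nrmM -mulrA mulrC ler_pM ?nrm_ge0 //.
  by rewrite mulr_ge0 ?nrm_ge0 // exprn_ge0 // mulr_ge0 // ltW.
  apply: le_trans (hk (mjoin be al)); rewrite ler_wpM2l ?nrm_ge0 // mdeg_join exprD.
  rewrite ler_peMr ?exprn_ge0 ?mulr_ge0 ?(ltW r10) // exprn_ege1 //.
  by rewrite (@le_trans _ _ r1) ?le_max ?lexx ?orbT // ler_peMl ?(ltW r10) // ler1n.
by rewrite lerDl.
Qed.

End Ccv.
(** * Entire functions and uniform convergence on compact sets *)

Section Topology.
Variables (R : realType).
Local Notation C := R[i].

(** The order of [R[i]] only compares numbers with the same imaginary part, so a positive epsilon is
    real. *)
Lemma eps_complex (e : C) : 0 < e -> exists2 d : R, 0 < d & e = d%:C%C.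
Proof.
case: e => a b; rewrite ltcE /= => /andP[/eqP -> a0].
by exists a.
Qed.

Lemma ball_nrm (x y : C^o) (d : R) : ball x d%:C%C y <-> nrm (x - y) < d.
Proof. by rewrite -ball_normE /ball_ /= normCE ltcR. Qed.

Lemma cvg_nrmP (T : Type) (G : set_system T) {FG : Filter G} (f : T -> C^o) (y : C^o) :
  f @ G --> y <-> forall e : R, 0 < e -> \forall x \near G, nrm (f x - y) <= e.
Proof.
split=> [/cvgrPdist_le h e e0|h].
  have e0' : 0 < e%:C%C :> C by rewrite ltcR.
  by apply: filterS (h _ e0') => x; rewrite normCE lecR nrm_distC.
apply/cvgrPdist_le => e /eps_complex[d d0 ->].
by apply: filterS (h _ d0) => x; rewrite normCE lecR nrm_distC.
Qed.

Lemma continuous_nrm : continuous (fun x : C^o => nrm x : R^o).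
Proof.
move=> x; apply/(@cvgrPdist_le R R^o _ (nbhs (x : C^o)) _) => e e0.
have /cvg_nrmP/(_ _ e0) : id @ x --> x by exact: cvg_id.
apply: filterS => y yx; apply: le_trans yx; rewrite ler_norml nrm_distC nrm_lerB andbT.
by rewrite lerNl opprB nrm_distC nrm_lerB.
Qed.

Lemma continuous_pair_complex : continuous (fun ab : R * R => (ab.1 +i* ab.2)%C : C^o).
Proof.
move=> [a b]; apply/cvg_nrmP => e e0.
have e20 : 0 < e / 2 by rewrite divr_gt0.
have h1 : \forall ab \near (a, b), `|a - (ab : R * R).1| <= e / 2.
  by have /cvgrPdist_le/(_ _ e20) : fst @ (a, b) --> a by exact: cvg_fst.
have h2 : \forall ab \near (a, b), `|b - (ab : R * R).2| <= e / 2.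
  by have /cvgrPdist_le/(_ _ e20) : snd @ (a, b) --> b by exact: cvg_snd.
apply: filterS2 h1 h2 => -[x y] h1 h2; rewrite /= in h1 h2.
rewrite (le_trans (nrm_le_ReIm _)) // [leRHS]splitr lerD //=.
  by rewrite distrC.
by rewrite distrC.
Qed.

(** A compact set containing the disc of radius [r]; its compactness comes from that of real
    segments. *)
Definition square (r : R) : set C^o :=
  (fun ab : R * R => (ab.1 +i* ab.2)%C : C^o) @` (`[-r, r] `*` `[-r, r]).

Lemma compact_square r : compact (square r).
Proof.
apply: continuous_compact; last by apply: compact_setX; exact: segment_compact.
by apply: continuous_subspaceT => x; exact: continuous_pair_complex.
Qed.

Lemma nrm_square r (x : C) : nrm x <= r -> square r x.
Proof.
move=> xr; exists (Re x, Im x); last by case: x {xr}.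
split; rewrite /= in_itv /= -ler_norml.
  exact: le_trans (Re_le_nrm x) xr.
exact: le_trans (Im_le_nrm x) xr.
Qed.

Lemma compact_rV_bounded m (K : set 'rV[C^o]_m) : compact K ->
  exists2 r : R, 0 < r & forall x, K x -> forall i, nrm (x ord0 i) <= r.
Proof.
move=> cK.
have h i : exists r : R, forall x, K x -> nrm (x ord0 i) <= r.
  have /compact_bounded[M [_ /(_ (M + 1))]] : compact ((fun x : 'rV[C^o]_m =>
    nrm (x ord0 i) : R^o) @` K).
    apply: continuous_compact => //; apply: continuous_subspaceT => x.
    apply: (@continuous_comp _ _ _ (fun x : 'rV[C^o]_m => x ord0 i) (fun y : C^o => nrm y : R^o)).
      exact: coord_continuous.
    exact: continuous_nrm.
  rewrite ltrDl ltr01 => /(_ isT) h; exists (M + 1) => x Kx.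
  have := h (nrm (x ord0 i)); rewrite /= ger0_norm ?nrm_ge0 //; apply.
  by exists x.
have [f hf] := choice h.
exists (\big[Num.max/1]_i f i) => [|x Kx i]; first by rewrite (lt_le_trans ltr01) // bigmax_ge_id.
by apply: le_trans (hf i x Kx) _; exact: le_bigmax.
Qed.

Lemma family_compactP m (s : nat -> 'rV[C^o]_m -> C^o) (F : 'rV[C^o]_m -> C^o) :
  {family compact, s @ \oo --> F} <->
  forall K, compact K -> forall e : R, 0 < e -> \forall k \near \oo,
    forall x, K x -> nrm (s k x - F x) <= e.
Proof.
split=> [/fam_cvgP h K cK e e0|h].
  have /(h K cK) : nbhs (F : {uniform` K -> C^o}) [set g | forall x, K x -> nrm (g x - F x) <= e].
    apply/uniform_nbhs; exists [set xy : C^o * C^o | ball xy.1 e%:C%C xy.2]; split.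
      by rewrite -entourage_ballE; exists e%:C%C => //=; rewrite ltcR.
    move=> g gF x Kx; have /ball_nrm/ltW := gF x Kx.
    by rewrite nrm_distC.
  by [].
apply/fam_cvgP => K cK P /uniform_nbhs[E [+ EP]].
rewrite -entourage_ballE => -[e /= /eps_complex[d d0 ->] dE].
have d20 : 0 < d / 2 by rewrite divr_gt0.
have := h K cK _ d20; apply: filterS => k sk; apply: EP => x Kx; apply: dE.
apply/ball_nrm => /=; rewrite nrm_distC (le_lt_trans (sk x Kx)) //.
by rewrite ltr_pdivrMr // ltr_pMr // ltr1n.
Qed.

End Topology.

(** * Unconditional sums of complex numbers *)

Section AbsoluteSum.
Variables (R : realType) (I : choiceType).
Local Notation C := R[i].
Implicit Types (a : I -> C) (A B : {fset I}).

Lemma partial_sumE a A : partial_sum (a : I -> C^o) A = \sum_(i <- A) a i :> C.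
Proof. by rewrite /partial_sum big_seq_fsetE. Qed.

Lemma sum_fset_sub a A B : (A `<=` B)%fset ->
  \sum_(i <- B) a i = \sum_(i <- A) a i + \sum_(i <- (B `\` A)%fset) a i.
Proof.
move=> AB; rewrite (big_fsetID _ (mem A)) /=; congr (_ + _); last first.
  by apply: eq_fbigl => i; rewrite !inE /= andbC.
by apply: eq_fbigl => i; rewrite !inE /=; apply/andP/idP => [[]|iA] //; split=> //;
  exact: (fsubsetP AB).
Qed.

(** Splitting [B] by the sign of the real part, and again by that of the imaginary part, gives four
    subsums without cancellation, each at most [M]. *)
Lemma sum_nrm_le4 a (M : R) B :
  (forall A, (A `<=` B)%fset -> nrm (\sum_(i <- A) a i) <= M) ->
  \sum_(i <- B) nrm (a i) <= 4 * M.
Proof.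
move=> h.
have half (f : C -> R) : {morph f : x y / x + y} -> f 0 = 0 -> (forall x, `|f x| <= nrm x) ->
    \sum_(i <- B) `|f (a i)| <= 2 * M.
  move=> fD f0 fle.
  have fsum (A : {fset I}) : f (\sum_(i <- A) a i) = \sum_(i <- A) f (a i) by exact: (big_morph
    f fD f0).
  rewrite (big_fsetID _ (fun i => 0 <= f (a i))) /= mulr_natl mulr2n lerD //.
    set A := [fset _ | _ in _ & _]%fset.
    rewrite (_ : \sum_(i <- A) _ = \sum_(i <- A) f (a i)).
      rewrite -fsum (le_trans (ler_norm _)) // (le_trans (fle _)) // h //.
      by apply/fsubsetP => i; rewrite !inE => /andP[].
    by apply: eq_big_seq => i; rewrite !inE => /andP[_ /ger0_norm].
  set A := [fset _ | _ in _ & _]%fset.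
  rewrite (_ : \sum_(i <- A) _ = - \sum_(i <- A) f (a i)).
    rewrite -fsum (le_trans (ler_norm _)) // normrN (le_trans (fle _)) // h //.
    by apply/fsubsetP => i; rewrite !inE => /andP[].
  rewrite -sumrN; apply: eq_big_seq => i; rewrite !inE => /andP[_].
  by rewrite -ltNge => /ltr0_norm.
have := half _ (@ReD R) (erefl _) (@Re_le_nrm R).
have := half _ (@ImD R) (erefl _) (@Im_le_nrm R).
have : \sum_(i <- B) nrm (a i) <= \sum_(i <- B) `|Re (a i)| + \sum_(i <- B) `|Im (a i)|.
  by rewrite -big_split /=; apply: ler_sum => i _; exact: nrm_le_ReIm.
lra.
Qed.

End AbsoluteSum.

(** * Entire power series and their polynomial approximations *)

Section EntireLimits.
Variables (R : realType) (m : nat).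
Local Notation C := R[i].
Implicit Types (c : 'X_{1..m} -> C).

Definition pterm c (x : 'I_m -> C) k : C := c k * \prod_i x i ^+ k i.

Lemma nrm_pterm c x k (r : R) : (forall i, nrm (x i) <= r) ->
  nrm (pterm c x k) <= nrm (c k) * r ^+ mdeg k.
Proof.
move=> xr; rewrite nrmM ler_wpM2l ?nrm_ge0 // mdegE -prodrXr nrm_prod.
apply: ler_prod => i _.
by rewrite nrm_ge0 nrmX lerXn2r // nnegrE ?nrm_ge0 // (le_trans _ (xr i)) ?nrm_ge0.
Qed.

Lemma nrm_pterm_eq c k (r : R) : 0 <= r ->
  nrm (pterm c (fun=> r%:C%C) k) = nrm (c k) * r ^+ mdeg k.
Proof. by move=> r0; rewrite nrmM prodrXr -mdegE nrmX nrm_real ger0_norm. Qed.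

Definition fpoly c (A : {fset 'X_{1..m}}) : {mpoly C[m]} := \sum_(k <- A) c k *: 'X_[k].

Lemma meval_fpoly c A x : (fpoly c A).@[x] = \sum_(k <- A) pterm c x k.
Proof. by rewrite /fpoly raddf_sum /=; apply: eq_bigr => k _; rewrite mevalZ mevalX. Qed.

Lemma mcoeff_fpoly c A k : (fpoly c A)@_k = if k \in A then c k else 0.
Proof.
rewrite /fpoly raddf_sum /= (eq_bigr (fun k' => if k' == k then c k else 0)); last first.
  by move=> k' _; rewrite mcoeffZ mcoeffX; case: eqP => [->|_]; rewrite ?mulr1 ?mulr0.
rewrite -big_mkcond /=; case: ifP => kA.
  by rewrite (big_rem k) //= eqxx big1_seq ?addr0 // => k' /andP[/eqP -> ];
    rewrite mem_rem_uniq ?fset_uniq // inE eqxx.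
by rewrite big1_seq // => k' /andP[/eqP ->]; rewrite kA.
Qed.

Lemma meval_split p (A : {fset 'X_{1..m}}) x :
  p.@[x] = \sum_(k <- A) pterm (fun k => p@_k) x k +
           \sum_(k <- msupp p | k \notin A) pterm (fun k => p@_k) x k.
Proof.
rewrite mevalE -[LHS]/(\sum_(k <- msupp p) pterm (fun k => p@_k) x k).
rewrite (bigID (fun k => k \in A)) /=; congr (_ + _).
rewrite [RHS](bigID (fun k => k \in msupp p)) /= [X in _ = _ + X]big1 ?addr0; last first.
  by move=> k /memN_msupp_eq0; rewrite /pterm => ->; rewrite mul0r.
rewrite -big_filter -[RHS]big_filter; apply: perm_big; apply: uniq_perm.
- by rewrite filter_uniq ?msupp_uniq.
- by rewrite filter_uniq ?fset_uniq.
by move=> k; rewrite !mem_filter andbC.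
Qed.

Lemma entire_cvgP c F : is_entire_function c F <->
  forall x : 'rV[C^o]_m, forall e : R, 0 < e -> exists A0 : {fset 'X_{1..m}},
    forall A, (A0 `<=` A)%fset -> nrm (\sum_(k <- A) pterm c (x ord0) k - F x) <= e.
Proof.
have FT := @totally_filter 'X_{1..m}.
split=> [h x e e0|h x].
  have /cvg_nrmP/(_ _ e0)[A0 _ hA0] := h x; exists A0 => A A0A.
  by have := hA0 A A0A; rewrite /= partial_sumE.
apply/cvg_nrmP => e e0; have [A0 hA0] := h x e e0.
by exists A0 => // A A0A /=; rewrite partial_sumE; exact: hA0.
Qed.

(** Unconditional convergence at the single point [(r, ..., r)] is absolute there and dominates the
    tails on the whole polydisc, so convergence is uniform on it. *)
Lemma entire_tail c F (r e : R) : is_entire_function c F -> 0 <= r -> 0 < e ->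
  exists A0 : {fset 'X_{1..m}}, forall A, (A0 `<=` A)%fset ->
    forall x : 'rV[C^o]_m, (forall i, nrm (x ord0 i) <= r) ->
    nrm (\sum_(k <- A) pterm c (x ord0) k - F x) <= e.
Proof.
(* Two partial sums differ by at most [e / 8], and [sum_nrm_le4] multiplies this by 4; the other
   [e / 2] is spent on the limit at [x]. *)
move=> /entire_cvgP cF r0 e0; have e16 : 0 < e / 16 by rewrite divr_gt0.
have [A0 hA0] := cF (\row__ (r%:C%C : C^o)) _ e16.
have xE : (\row_(_ < m) (r%:C%C : C^o)) ord0 = (fun=> r%:C%C) by apply/funext => i; rewrite mxE.
rewrite xE in hA0.
have tail (B : {fset 'X_{1..m}}) : (forall k, k \in B -> k \notin A0) ->
    \sum_(k <- B) nrm (c k) * r ^+ mdeg k <= e / 2.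
  move=> BA0; under eq_bigr do rewrite -nrm_pterm_eq //.
  have -> : e / 2 = 4 * (e / 8) by field.
  apply: sum_nrm_le4 => A AB.
  have AE : (A = (A0 `|` A) `\` A0)%fset.
    apply/fsetP => k; rewrite !inE; case kA: (k \in A); last by rewrite orbF andNb.
    by rewrite orbT andbT BA0 // (fsubsetP AB).
  have := sum_fset_sub (pterm c (fun=> r%:C%C)) (fsubsetUl A0 A); rewrite -AE.
  move=> /esym/(canRL (addKr _)) ->; rewrite addrC.
  have h1 := hA0 _ (fsubsetUl A0 A); have h2 := hA0 _ (fsubset_refl A0).
  move: h1 h2; set s1 := \sum_(_ <- _) _; set s2 := \sum_(_ <- A0) _; set Fx := F _ => h1 h2.
  have -> : s1 - s2 = (s1 - Fx) - (s2 - Fx) by rewrite opprB addrA subrK.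
  by rewrite (le_trans (nrmB _ _)) //; lra.
exists A0 => A A0A x xr.
have e20 : 0 < e / 2 by rewrite divr_gt0.
have [A1 hA1] := cF x _ e20.
have := hA1 _ (fsubsetUr A A1); rewrite (sum_fset_sub _ (fsubsetUl A A1)).
set s1 := \sum_(_ <- A) _; set s2 := \sum_(_ <- _) _ => h.
have s2e : nrm s2 <= e / 2.
  rewrite (le_trans (nrm_sum _ _ _)) //; apply: le_trans (tail ((A `|` A1) `\` A)%fset _).
    by apply: ler_sum => k _; exact: nrm_pterm.
  by move=> k; rewrite !inE => /andP[kA _]; apply: contra kA; exact: (fsubsetP A0A).
have -> : s1 - F x = (s1 + s2 - F x) - s2 by rewrite [RHS]addrAC addrK.
by rewrite (le_trans (nrmB _ _)) // [leRHS]splitr lerD.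
Qed.

(** Cauchy's estimate for the difference of [s k] and a partial sum of [c]. Both are close to [F] on
    the polydisc, uniformly in the index [kk], which is added to the partial sum. *)
Lemma coef_cvg_of_compact_limit c F (s : nat -> {mpoly C[m]}) :
  is_entire_function c F -> {family compact, (fun k => mpoly_fun (s k)) @ \oo --> F} ->
  coef_cvg s c.
Proof.
move=> cF /family_compactP sF r e e0.
pose r1 := `|r|; have r10 : 0 <= r1 by exact: normr_ge0.
have e20 : 0 < e / 2 by rewrite divr_gt0.
have [A0 hA0] := entire_tail cF r10 e20.
have := sF _ (rV_compact (fun _ : 'I_m => @compact_square R r1)) _ e20.
apply: filterS => k hk kk.
apply: (@le_trans _ _ (nrm ((s k)@_kk - c kk) * r1 ^+ mdeg kk)).
  by rewrite ler_wpM2l ?nrm_ge0 // -normrX ler_norm.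
pose A := (A0 `|` [fset kk])%fset.
have -> : (s k)@_kk - c kk = (s k - fpoly c A)@_kk.
  by rewrite mcoeffB mcoeff_fpoly !inE eqxx orbT.
apply: cauchy_mpoly => // z zr.
pose x : 'rV[C^o]_m := \row_i (z i : C^o).
have xE : x ord0 = z by apply/funext => i; rewrite mxE.
have h1 := hA0 A (fsubsetUl _ _) x; have h2 := hk x.
rewrite xE in h1; rewrite mevalB meval_fpoly.
have zr1 i : nrm (z i) <= r1 by rewrite zr.
have {}h1 := h1 zr1.
have {}h2 : nrm (mpoly_fun (s k) x - F x) <= e / 2.
  by apply: h2 => i /=; rewrite xE; apply: nrm_square; rewrite zr.
rewrite /mpoly_fun xE in h2; move: h1 h2.
set a := \sum_(_ <- _) _; set b := (_).@[_]; set f := F x => h1 h2.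
have -> : b - a = (b - f) - (a - f) by rewrite opprB addrA subrK.
by rewrite (le_trans (nrmB _ _)) // [leRHS]splitr lerD.
Qed.

Definition entire_coefs c := forall rho : R, 0 < rho -> exists K : R,
  forall k, nrm (c k) * rho ^+ mdeg k <= K.

Lemma entire_coefs_tail c (r e : R) : entire_coefs c -> 0 < r -> 0 < e ->
  exists D, forall B : seq 'X_{1..m}, uniq B -> (forall k, k \in B -> (D <= mdeg k)%N) ->
    \sum_(k <- B) nrm (c k) * r ^+ mdeg k <= e.
Proof.
move=> ce r0 e0; have [K hK] := ce (r * 4) (mulr_gt0 r0 (ltr0n _ 4)).
have K0 : 0 <= K.
  by apply: le_trans (hK 0%MM); rewrite mulr_ge0 ?nrm_ge0 // exprn_ge0 // mulr_ge0 // ltW.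
have [D hD] : exists D, K * 2 ^+ m * 2^-1 ^+ D <= e.
  pose b := K * 2 ^+ m + 1; have b0 : 0 < b by rewrite ltr_wpDl // mulr_ge0 // exprn_ge0.
  have /cvgrPdist_le/(_ _ (divr_gt0 e0 b0)) : (fun D => (2^-1 : R) ^+ D) @ \oo --> 0.
    by apply: cvg_expr; rewrite ger0_norm ?invr_ge0 // invf_lt1 // ltr1n.
  case=> D _ /(_ D (leqnn _)); rewrite sub0r normrN ger0_norm ?exprn_ge0 ?invr_ge0 // => h.
  exists D; rewrite -[e](divfK (lt0r_neq0 b0)) mulrC ler_pM ?exprn_ge0 ?invr_ge0 //.
    by rewrite mulr_ge0 // exprn_ge0.
  by rewrite /b lerDl.
exists D => B uB BD; apply: le_trans hD.
rewrite -mulrA mulrCA mulrC.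
apply: (@le_trans _ _ (\sum_(k <- B) K * 2^-1 ^+ D * 2^-1 ^+ mdeg k)); last first.
  by rewrite -mulr_sumr ler_wpM2l ?mulr_ge0 ?exprn_ge0 ?invr_ge0 // sum_half_mdeg.
rewrite big_seq [leRHS]big_seq; apply: ler_sum => k /BD Dk.
apply: (@le_trans _ _ (K * 2^-1 ^+ mdeg k * 2^-1 ^+ mdeg k)); last first.
  rewrite ler_wpM2r ?exprn_ge0 ?invr_ge0 // ler_wpM2l // ler_wiXn2l ?invr_ge0 //.
  by rewrite invf_le1 // ler1n.
have := hK k; rewrite exprMn -[4]/(2 * 2)%:R natrM exprMn -ler_pdivlMr; last first.
  by rewrite mulr_gt0 ?exprn_gt0 // mulr_gt0 // exprn_gt0.
rewrite !invfM -!exprVn => h; rewrite -ler_pdivlMr ?exprn_gt0 // -exprVn.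
by rewrite (le_trans h) // le_eqVlt; apply/orP; left; apply/eqP; ring.
Qed.

Lemma low_fset D : exists A : {fset 'X_{1..m}}, forall k, (k \in A) = (mdeg k < D)%N.
Proof.
exists [fset val k | k in enum {: 'X_{1..m < D}}]%fset => k.
apply/imfsetP/idP => [[k' _ ->]|kD]; first exact: bmdeg.
by exists (BMultinom kD); rewrite //= mem_enum.
Qed.

Lemma loc_cvg_fpoly c (theta : nat -> 'X_{1..m} -> R) (A : {fset 'X_{1..m}}) :
  (forall kk, (fun k => theta k kk) @ \oo --> (1 : R)) ->
  loc_cvg (fun k => fpoly (fun kk => c kk * (theta k kk)%:C%C) A) (fpoly c A).
Proof.
move=> th1; apply: loc_cvg_sum => kk; apply: loc_cvgZ => d d0.
pose b := nrm (c kk) + 1; have b0 : 0 < b by rewrite ltr_wpDl ?nrm_ge0.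
apply: filterS (cvg_near_nrm (th1 kk) (divr_gt0 d0 b0)) => k hk.
rewrite -[X in _ - X]mulr1 -mulrBr nrmM mulrC -[d](divfK (lt0r_neq0 b0)).
by rewrite ler_pM ?nrm_ge0 // /b lerDl.
Qed.

(** Dominated convergence: as [theta <= 1], the terms of high degree are small for [c] and for all
    [s k] at once, while the finitely many remaining ones converge because [theta] tends to 1. *)
Lemma entire_limit c (theta : nat -> 'X_{1..m} -> R) (s : nat -> {mpoly C[m]}) :
  entire_coefs c ->
  (forall k kk, 0 <= theta k kk <= 1) ->
  (forall kk, (fun k => theta k kk) @ \oo --> (1 : R)) ->
  (forall k kk, (s k)@_kk = c kk * (theta k kk)%:C%C) ->
  exists F : 'rV[C^o]_m -> C^o, is_entire_function c F /\
    {family compact, (fun k => mpoly_fun (s k)) @ \oo --> F}.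
Proof.
move=> ce th01 th1 sE.
have FT := @totally_filter 'X_{1..m}.
have bound (x : 'rV[C^o]_m) : exists2 r : R, 0 < r & forall i, nrm (x ord0 i) <= r.
  exists (\big[Num.max/1]_i nrm (x ord0 i)) => [|i]; last exact: le_bigmax.
  by rewrite (lt_le_trans ltr01) // bigmax_ge_id.
have tail (r e : R) : 0 < r -> 0 < e -> exists A0 : {fset 'X_{1..m}},
    forall A, (A0 `<=` A)%fset -> forall x : 'I_m -> C, (forall i, nrm (x i) <= r) ->
    nrm (\sum_(k <- A) pterm c x k - \sum_(k <- A0) pterm c x k) <= e /\
    forall k, nrm (\sum_(k' <- msupp (s k) | k' \notin A0) pterm (fun kk => (s k)@_kk) x k') <= e.
  move=> r0 e0; have [D hD] := entire_coefs_tail ce r0 e0.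
  have [A0 hA0] := low_fset D; exists A0 => A A0A x xr; split.
    rewrite (sum_fset_sub _ A0A) addrC addKr (le_trans (nrm_sum _ _ _)) //.
    apply: le_trans (hD (A `\` A0)%fset (fset_uniq _) _).
      by apply: ler_sum => k _; exact: nrm_pterm.
    by move=> k; rewrite !inE hA0 -leqNgt => /andP[].
  move=> k; rewrite -big_filter (le_trans (nrm_sum _ _ _)) //.
  apply: le_trans (hD _ (filter_uniq _ (msupp_uniq (s k))) _).
    apply: ler_sum => k' _; apply: le_trans (nrm_pterm _ _ xr) _.
    rewrite ler_wpM2r ?exprn_ge0 ?(ltW r0) // sE nrmM nrm_real.
    by have /andP[t0 t1] := th01 k k'; rewrite ler_piMr ?nrm_ge0 // ger0_norm.
  by move=> k'; rewrite mem_filter hA0 -leqNgt => /andP[].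
pose S (x : 'rV[C^o]_m) (A : {fset 'X_{1..m}}) := \sum_(k <- A) pterm c (x ord0) k.
have cvgS (f : C -> R) x : (forall y z, `|f y - f z| <= nrm (y - z)) ->
    cvg ((fun A => f (S x A)) @ totally).
  move=> fle; apply: R_complete; apply: cauchy_exP => e /= e0.
  have [r r0 xr] := bound x; have e20 : 0 < e / 2 by rewrite divr_gt0.
  have [A0 hA0] := tail r _ r0 e20; exists (f (S x A0)); exists A0 => // A A0A.
  have [h _] := hA0 A A0A _ xr; rewrite /= -ball_normE /ball_ /= distrC.
  rewrite (le_lt_trans (fle _ _)) // (le_lt_trans h) //.
  by rewrite ltr_pdivrMr // ltr_pMr // ltr1n.
have fRe y z : `|Re y - Re z| <= nrm (y - z :> C) by rewrite -ReN -ReD Re_le_nrm.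
have fIm y z : `|Im y - Im z| <= nrm (y - z :> C) by rewrite -ImN -ImD Im_le_nrm.
(* The sum is built from its real and imaginary parts, which converge by completeness of [R]. *)
pose F x : C^o := (lim ((fun A => Re (S x A)) @ totally) +i* lim ((fun A =>
  Im (S x A)) @ totally))%C.
have SF x (e : R) : 0 < e -> exists A0 : {fset 'X_{1..m}}, forall A, (A0 `<=` A)%fset -> nrm (S
  x A - F x) <= e.
  move=> e0; have e20 : 0 < e / 2 by rewrite divr_gt0.
  have /cvgrPdist_le/(_ _ e20)[A1 _ h1] := cvgS _ x fRe.
  have /cvgrPdist_le/(_ _ e20)[A2 _ h2] := cvgS _ x fIm.
  exists (A1 `|` A2)%fset => A; rewrite fsubUset => /andP[/h1 {}h1 /h2 {}h2].
  rewrite (le_trans (nrm_le_ReIm _)) // [leRHS]splitr lerD //.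
    by rewrite ReD ReN /= distrC.
  by rewrite ImD ImN /= distrC.
exists F; split; first by apply/entire_cvgP => x e e0; exact: SF.
apply/family_compactP => K /compact_rV_bounded[r r0 Kr] e e0.
have e60 : 0 < e / 6 by rewrite divr_gt0.
have [A0 hA0] := tail r _ r0 e60.
have := @loc_cvg_fpoly c _ A0 th1.
move=> /(_ r _ e60); apply: filterS => k hk x Kx.
have xr := Kr x Kx; have [A1 hA1] := SF x _ e60.
have [h1 h2] := hA0 _ (fsubsetUl A0 A1) _ xr; have {}h2 := h2 k.
have h3 := hA1 _ (fsubsetUr A0 A1); have h4 := hk _ xr.
pose p := fpoly (fun kk => c kk * (theta k kk)%:C%C) A0.
have pE : p.@[x ord0] = \sum_(kk <- A0) pterm (fun kk => (s k)@_kk) (x ord0) kk.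
  by rewrite /p meval_fpoly; apply: eq_bigr => kk _; rewrite /pterm sE.
have h5 : mpoly_fun (s k) x = p.@[x ord0] +
    \sum_(k' <- msupp (s k) | k' \notin A0) pterm (fun kk => (s k)@_kk) (x ord0) k'.
  by rewrite /mpoly_fun (meval_split _ A0) pE.
rewrite -/p (meval_fpoly c A0) in h4; rewrite h5; move: h1 h2 h3 h4; rewrite /S.
set a1 := \sum_(_ <- (_ `|` _)%fset) _; set a2 := \sum_(_ <- A0) _.
set a3 := \sum_(_ <- _ | _) _; set a4 := meval (x ord0) _ => h1 h2 h3 h4.
have -> : a4 + a3 - F x = (a4 - a2) + a3 - (a1 - a2) + (a1 - F x) by ring.
rewrite (le_trans (nrmD _ _)) // (le_trans (lerD (nrmB _ _) (lexx _))) //.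
rewrite (le_trans (lerD (lerD (nrmD _ _) (lexx _)) (lexx _))) //.
rewrite (le_trans (lerD (lerD (lerD h4 h2) h1) h3)) //; lra.
Qed.

End EntireLimits.
(** * Decay of the coefficients of a limit of stable polynomials *)

Section FiniteDifferences.
Variable R : realType.

(** There are [2^a] nodes, each of weight [a^a / a! <= e^a] after normalization. *)
Definition fd_rate : R := 2 * expR 1.

(* Signed nodes of the iterated forward difference of step [h] at [1]. *)
Fixpoint fd_nodes (h : R) (a : nat) : seq (R * R) :=
  if a is a'.+1 then
    [seq (w.1, w.2 + h) | w <- fd_nodes h a'] ++ [seq (- w.1, w.2) | w <- fd_nodes h a']
  else [:: (1, 1)].

(** The difference [Q = P(x + h) - P(x)] has lower degree, and its coefficient of degree [a] is
    [(a + 1) h] times that of [P] of degree [a + 1]. *)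
Lemma fd_nodesP h a (P : {poly R}) : (size P <= a.+1)%N ->
  \sum_(w <- fd_nodes h a) w.1 * P.[w.2] = P`_a * a`!%:R * h ^+ a.
Proof.
elim: a P => [|a IH] P sP.
  rewrite big_seq1 /= mul1r expr0 !mulr1 [in LHS](size1_polyC sP) hornerC //.
pose Q := \sum_(1 <= i < (size P).+1) h ^+ i *: P^`N(i).
have QE x : Q.[x] = P.[x + h] - P.[x].
  rewrite (@nderiv_taylor_wide _ (size P).+1) //; last exact: mulrC.
  rewrite -(big_mkord xpredT (fun i => P^`N(i).[x] * h ^+ i)) big_nat_recl // nderivn0 expr0 mulr1.
  rewrite [RHS]addrC addKr /Q big_add1 horner_sum.
  by apply: eq_bigr => i _; rewrite hornerZ mulrC.
have Qc n : Q`_n = \sum_(1 <= i < (size P).+1) h ^+ i * (P`_(i + n) *+ 'C(i + n, i)).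
  by rewrite /Q coef_sum; apply: eq_bigr => i _; rewrite coefZ coef_nderivn.
have sQ : (size Q <= a.+1)%N.
  apply/leq_sizeP => j aj; rewrite Qc big_nat big1 // => i /andP[i1 _].
  by rewrite nth_default ?mul0rn ?mulr0 // (leq_trans sP) // -add1n leq_add.
rewrite /= big_cat /= !big_map -big_split /=.
under eq_bigr => w _ do rewrite mulNr -mulrBr -QE.
rewrite IH // Qc; have [P0|P0] := posnP (size P).
  by rewrite P0 big_geq // nth_default ?P0 // !mul0r.
rewrite big_nat_recl // [X in _ + X]big_nat big1 => [|i /andP[i1 _]]; last first.
  by rewrite nth_default ?mul0rn ?mulr0 //; apply: leq_trans sP _; lia.
by rewrite addr0 expr1 add1n bin1 -mulr_natr factS natrM exprS; ring.
Qed.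

Lemma fd_nodes_range h a w : 0 <= h -> w \in fd_nodes h a ->
  `|w.1| = 1 /\ 1 <= w.2 <= 1 + h *+ a.
Proof.
move=> h0; elim: a w => [|a IH] w /=.
  by rewrite inE => /eqP -> /=; rewrite normr1 mulr0n addr0 lexx.
rewrite mem_cat => /orP[] /mapP[w' /IH[w1 /andP[w2 w3]] ->] /=; rewrite ?normrN; split=> //.
  by rewrite mulrSr addrA lerD2r w3 (le_trans w2) ?lerDl.
by rewrite w2 (le_trans w3) // lerD2l mulrSr lerDl.
Qed.

Lemma size_fd_nodes h a : size (fd_nodes h a) = (2 ^ a)%N.
Proof. by elim: a => //= a IH; rewrite size_cat !size_map IH addnn expnS mul2n. Qed.

(** By induction, from [(1 + 1/a)^a <= e]. *)
Lemma expn_fact a : (a%:R : R) ^+ a <= expR 1 ^+ a * a`!%:R.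
Proof.
elim: a => [|a IH]; first by rewrite !expr0 mulr1.
have [->|a0] := posnP a; first by rewrite !expr1 mulr1; apply: le_trans (expR_ge1Dx 1);
  rewrite lerDl.
have h : a.+1%:R ^+ a <= expR 1 * a%:R ^+ a :> R.
  have aR : (0 : R) < a%:R by rewrite ltr0n.
  rewrite -ler_pdivrMr ?exprn_gt0 // -expr_div_n -addn1 natrD mulrDl divff ?lt0r_neq0 // mul1r.
  rewrite -[X in expR X](divff (lt0r_neq0 aR)) expRM_natl lerXn2r ?nnegrE ?expR_ge0 ?expR_ge1Dx //.
rewrite exprSr; apply: (@le_trans _ _ (expR 1 * a%:R ^+ a * a.+1%:R)); first by rewrite ler_wpM2r.
rewrite factS natrM exprS -!mulrA ler_wpM2l ?expR_ge0 // mulrCA mulrC [leRHS]mulrC.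
by rewrite mulrC ler_wpM2r.
Qed.

(** Finite differences of step [1 / a] extract the coefficient of degree [a] from a polynomial of
    degree at most [a], with nodes in [[1, 2]] and a total weight growing only geometrically. *)
Lemma fd_functional : exists W : nat -> seq (R * R), forall a,
  [/\ forall w, w \in W a -> 1 <= w.2 <= 2,
      \sum_(w <- W a) `|w.1| <= fd_rate ^+ a &
      forall k, (k <= a)%N -> \sum_(w <- W a) w.1 * w.2 ^+ k = (k == a)%:R].
Proof.
(* [b a] is the inverse of [a! h^a]. For [a = 0] the step is [0^-1 = 0] and [b] is 1, in accordance
   with the single node 1. *)
pose h a : R := a%:R^-1; pose b a : R := a%:R ^+ a / a`!%:R.
exists (fun a => [seq (w.1 * b a, w.2) | w <- fd_nodes (h a) a]) => a.
have h0 : 0 <= h a by rewrite invr_ge0.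
have f0 : (0 : R) < a`!%:R by rewrite ltr0n fact_gt0.
have b0 : 0 <= b a by rewrite divr_ge0 ?exprn_ge0 // ltW.
split=> [w /mapP[w' ww' ->] /=||k ka].
- have [_ /andP[-> w2]] := fd_nodes_range h0 ww'; rewrite (le_trans w2) //.
  suff : h a *+ a <= 1 by lra.
  rewrite /h -(mulr_natr (a%:R^-1) a); have [->|a0] := posnP a; first by rewrite mulr0.
  by rewrite mulVf // pnatr_eq0 -lt0n.
- rewrite big_map big_seq (eq_bigr (fun=> b a)); last first.
    by move=> w /(fd_nodes_range h0)[w1 _]; rewrite /= normrM w1 mul1r ger0_norm.
  rewrite -big_seq big_const_seq count_predT iter_addr_0 size_fd_nodes.
  rewrite -mulr_natl natrX /fd_rate exprMn ler_wpM2l ?exprn_ge0 //.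
  by rewrite /b ler_pdivrMr // expn_fact.
rewrite big_map /=.
rewrite (eq_bigr (fun w => b a * (w.1 * ('X^k : {poly R}).[w.2]))); last first.
  by move=> w _; rewrite hornerXn mulrAC mulrC mulrA.
rewrite -mulr_sumr fd_nodesP ?size_polyXn // coefXn eq_sym.
case: eqP => _; last by rewrite !mul0r mulr0.
rewrite mul1r /b /h; have [->|a0] := posnP a; first by rewrite !expr0 fact0 divr1 !mulr1.
by rewrite exprVn -mulrA mulKf ?lt0r_neq0 // divff // expf_neq0 // pnatr_eq0 -lt0n.
Qed.

End FiniteDifferences.

(** * Homogeneous parts along positive real directions *)

Section HomogeneousParts.
Variables (R : realType) (m : nat).
Local Notation C := R[i].
Implicit Types (p : {mpoly C[m]}).

(** A tensor product of the functionals of orders [k i], applied in the direction [v]: another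
    monomial of the same degree has an exponent smaller than [k i] for some [i], and that functional
    kills it. *)
Lemma homog_coef_bound p k (B : R) :
  (forall v : 'I_m -> R, (forall i, 1 <= v i <= 2) ->
     nrm (line (fun=> 0) (fun i => (v i)%:C%C) p)`_(mdeg k) <= B) ->
  nrm p@_k <= fd_rate R ^+ mdeg k * B.
Proof.
move=> hB; have [W hW] := fd_functional R.
pose N := \max_(i < m) size (W (k i)).
(* The lists are padded by the node 1 with weight 0, which contributes nothing and lies in
   [[1, 2]]. *)
pose w i b : R * R := nth (0, 1) (W (k i)) b.
have wN (F : R * R -> R) i : F (0, 1) = 0 ->
    \sum_(b < N) F (w i b) = \sum_(u <- W (k i)) F u.
  move=> F0; have sN : (size (W (k i)) <= N)%N by exact: (leq_bigmax i).
  rewrite [RHS](big_nth (0, 1)) big_mkord (big_ord_widen _ (fun b =>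
    F (w i b)) sN) [RHS]big_mkcond /=.
  by apply: eq_bigr => b _; case: ltnP => // bs; rewrite /w nth_default.
have w12 i b : 1 <= (w i b).2 <= 2.
  rewrite /w; have [bs|bs] := ltnP b (size (W (k i))).
    by have [h _ _] := hW (k i); rewrite h // mem_nth.
  by rewrite nth_default //= lexx ler1n.
pose L (f : {ffun 'I_m -> 'I_N}) : R := \prod_i (w i (f i)).1.
have E : p@_k = \sum_(f : {ffun 'I_m -> 'I_N}) (L f)%:C%C *
    (line (fun=> 0) (fun i => ((w i (f i)).2)%:C%C) p)`_(mdeg k).
  under eq_bigr do rewrite coef_line0 mulr_sumr.
  rewrite exchange_big /=.
  rewrite (eq_bigr (fun k' => p@_k' * (\prod_i \sum_(b < N) (w i b).1 * (w i b).2 ^+ k'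
    i)%:C%C)); last first.
    move=> k' _; rewrite bigA_distr_bigA rmorph_sum mulr_sumr /=; apply: eq_bigr => f _.
    rewrite big_split rmorphM /= mulrCA; congr (_ * (_ * _)).
    by rewrite rmorph_prod; apply: eq_bigr => i _; rewrite rmorphXn.
  rewrite (eq_bigr (fun k' => if k' == k then p@_k else 0)); last first.
    move=> k' /eqP k'k; case: eqP => [->|/eqP ne].
      rewrite big1 ?rmorph1 ?mulr1 // => i _; have [_ _ h] := hW (k i).
      rewrite (wN (fun u => u.1 * u.2 ^+ k i)) /= ?mul0r //.
      by rewrite h // eqxx.
    have [i ki] : exists i, (k' i < k i)%N.
      apply: contrapT => h; move/eqP: ne; apply; apply/mnmP.
      have le i : (k i <= k' i)%N by rewrite leqNgt; apply/negP => hi; apply: h; exists i.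
      move=> i; apply/eqP; rewrite eq_sym eqn_leq le /=; move: k'k; rewrite !mdegE.
      rewrite (bigD1 i) //= [in RHS](bigD1 i) //= => e.
      have : (\sum_(j < m | j != i) k j <= \sum_(j < m | j != i) k' j)%N by exact: leq_sum.
      by rewrite -(leq_add2l (k i)) -e leq_add2r.
    have [_ _ h] := hW (k i).
    rewrite (bigD1 i) //= (wN (fun u => u.1 * u.2 ^+ k' i)) /= ?mul0r // h ?(ltnW ki) //.
    by rewrite (ltn_eqF ki) mul0r mulr0.
  rewrite -big_mkcondr /=; have [kp|kp] := boolP (k \in msupp p).
    rewrite (big_rem k) //= eqxx eqxx big1_seq ?addr0 // => k' /andP[/andP[_ /eqP ->]].
    by rewrite mem_rem_uniq ?msupp_uniq // inE eqxx.
  rewrite (memN_msupp_eq0 kp) big1 //.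
rewrite {1}E (le_trans (nrm_sum _ _ _)) //.
apply: (@le_trans _ _ (\sum_(f : {ffun 'I_m -> 'I_N}) `|L f| * B)).
  apply: ler_sum => f _; rewrite nrmM nrm_real ler_wpM2l //; exact: hB.
have B0 : 0 <= B.
  by apply: le_trans (hB (fun=> 1) _) => [|i]; rewrite ?nrm_ge0 // lexx ler1n.
rewrite -mulr_suml ler_wpM2r //.
rewrite (eq_bigr (fun f : {ffun 'I_m -> 'I_N} => \prod_i `|(w i (f i)).1|)); last first.
  by move=> f _; rewrite normr_prod.
rewrite -(bigA_distr_bigA (fun i (b : 'I_N) => `|(w i b).1|)) /= mdegE -prodrXr.
apply: ler_prod => i _; rewrite sumr_ge0 //=.
by rewrite (wN (fun u => `|u.1|)) /= ?normr0 //; have [_ h _] := hW (k i).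
Qed.

Definition hpart d p : {mpoly C[m]} := monmap (fun k => (mdeg k == d)%:R) id p.

Lemma mcoeff_hpart d p k : (hpart d p)@_k = p@_k * (mdeg k == d)%:R.
Proof.
rewrite /hpart; elim/mpolyind: p => [|b k' q _ _ IH]; first by rewrite linear0 !mcoeff0 mul0r.
rewrite linearP /= monmapX !(mcoeffD, mcoeffZ) IH mulrDl mcoeffX; congr (_ + _).
by case: (eqVneq k' k) => [->|_]; rewrite ?(mulr0, mul0r, mulr1).
Qed.

Lemma meval_hpart d p v : (hpart d p).@[v] = (line (fun=> 0) v p)`_d.
Proof.
rewrite meval_monmap coef_line0 [RHS]big_mkcond /=; apply: eq_bigr => k _.
by case: eqP; rewrite ?mulr1 ?mulr0 ?mul0r.
Qed.

Lemma meval_hpartZ d p a v : (hpart d p).@[fun i => a * v i] = a ^+ d * (hpart d p).@[v].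
Proof.
rewrite !meval_monmap mulr_sumr; apply: eq_bigr => k _.
have [kd|] := eqVneq (mdeg k) d; last by rewrite !mulr0 !mul0r mulr0.
rewrite mulr1 mulrCA -[in RHS]kd mdegE -prodrXr -big_split /=; congr (_ * _).
by apply: eq_bigr => i _; rewrite exprMn.
Qed.

(** The lowest part is the limit of [a^-d p(a z)] as the positive [a] tends to 0. *)
Lemma stable0_hpart d p : stable p -> (forall k, (mdeg k < d)%N -> p@_k = 0) ->
  stable0 (hpart d p).
Proof.
move=> pS p0; pose phi l (k : 'X_{1..m}) : C := l.+1%:R^-1 ^+ (mdeg k - d).
apply: (@hurwitz R m (fun l => monmap (phi l) id p)) => [l|].
  left => z zH; have [a a0 aE] := natinvC_gt0 R l.
  have l0 : (l.+1%:R^-1 : C) ^+ d != 0 by rewrite expf_neq0 // invr_eq0 pnatr_eq0.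
  have E : (monmap (phi l) id p).@[z] * l.+1%:R^-1 ^+ d = p.@[fun i => l.+1%:R^-1 * z i].
    rewrite meval_monmap mevalE mulr_suml big_seq [RHS]big_seq; apply: eq_bigr => k kp.
    have dk : (d <= mdeg k)%N.
      by rewrite leqNgt; apply: contraL kp => /p0/eqP; rewrite mcoeff_eq0.
    rewrite -!mulrA; congr (_ * _); rewrite mulrCA /phi -exprD subnK //.
    by rewrite mdegE -prodrXr -big_split /=; apply: eq_bigr => i _; rewrite exprMn mulrC.
  suff : (monmap (phi l) id p).@[z] * l.+1%:R^-1 ^+ d != 0 by rewrite mulf_eq0 negb_or => /andP[].
  by rewrite E; apply: pS => i; rewrite aE /H0 /= ImZ mulr_gt0 //; exact: zH.
have -> : hpart d p = monmap (fun k => (mdeg k <= d)%:R) id p.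
  rewrite /hpart /monmap big_seq [RHS]big_seq; apply: eq_bigr => k kp.
  have dk : (d <= mdeg k)%N.
    by rewrite leqNgt; apply: contraL kp => /p0/eqP; rewrite mcoeff_eq0.
  by rewrite eqn_leq dk andbT.
apply: loc_cvg_monmap => k e e0; rewrite /phi -subn_eq0; case: (mdeg k - d)%N => [|j].
  by near=> l; rewrite expr0 subrr nrm0 ltW.
apply: filterS (natinv_cvg 1 e0) => l; rewrite mulr1 !subr0 nrmX => h.
apply: le_trans h; rewrite exprS ler_piMr ?nrm_ge0 // exprn_ile1 ?nrm_ge0 //.
by rewrite nrmV nrm_nat invf_le1 // ler1n.
Unshelve. all: by end_near.
Qed.

(** By homogeneity both points may be multiplied by [i]. Then [t |-> i + (v - 1) t] joins them, with
    the values [t = 0] and [t = i], and it maps the upper half plane into the half planes because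
    [v >= 1]. *)
Lemma nrm_hpart_mono d p (v : 'I_m -> R) : stable (hpart d p) -> (forall i, 1 <= v i) ->
  nrm (hpart d p).@[fun=> 1] <= nrm (hpart d p).@[fun i => (v i)%:C%C].
Proof.
move=> hS v1; set h := hpart d p in hS *.
have nI (u : 'I_m -> C) : nrm h.@[u] = nrm h.@[fun i => 'i%C * u i].
  by rewrite meval_hpartZ nrmM nrmX (_ : nrm 'i%C = 1) ?expr1n ?mul1r //= expr0n expr1n add0r
    sqrtr1.
rewrite (nI (fun=> 1)) [leRHS]nI.
have := @nrm_upper_mono R (line (fun=> 'i%C * 1) (fun i => (v i - 1)%:C%C) h).
rewrite horner_line0 horner_line.
have -> : h.@[fun i => 'i%C * 1 + (v i - 1)%:C%C * 'i%C] = h.@[fun i => 'i%C * (v i)%:C%C].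
  by apply: meval_eq => i; rewrite rmorphB rmorph1 mulrC -mulrDl addrC subrK mulrC.
apply=> t t0; rewrite horner_line; apply: hS => i.
rewrite /H0 /= mulr1 ImD ImZ /= ltr_pwDl // mulr_ge0 ?subr_ge0 ?v1 // ltW //.
Qed.

(** In each real direction [v], [p(t v) / t^d] is stable with a constant term bounded below, so
    Szasz' bound and Cauchy's estimate control its coefficients; [homog_coef_bound] passes to those
    of [p]. *)
Lemma stable_coef_bound p d (del A r : R) : stable p ->
  (forall k, (mdeg k < d)%N -> p@_k = 0) -> stable (hpart d p) ->
  0 < del -> del <= nrm (hpart d p).@[fun=> 1] ->
  (forall (v : 'I_m -> R) j, (forall i, 1 <= v i <= 2) -> (j < 3)%N ->
     nrm (line (fun=> 0) (fun i => (v i)%:C%C) p)`_(d + j) <= A) ->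
  0 < r -> forall k, nrm p@_k * r ^+ mdeg k <= fd_rate R ^+ mdeg k * (szasz_const del A r * r ^+ d).
Proof.
move=> pS p0 hS del0 hdel hA r0 k.
have rk0 j : 0 < r ^+ j by rewrite exprn_gt0.
rewrite -ler_pdivlMr // -mulrA; apply: homog_coef_bound => v v12; rewrite ler_pdivlMr //.
set q := line _ _ _.
have v0 i : 0 < v i by have /andP[h _] := v12 i; rewrite (lt_le_trans ltr01).
have q0 j : (j < d)%N -> q`_j = 0.
  move=> jd; rewrite coef_line0 big1 // => k' /eqP kj.
  by rewrite p0 ?kj // mul0r.
have qE : q = drop_poly d q * 'X^d.
  rewrite -[LHS](poly_take_drop d) (_ : take_poly d q = 0) ?add0r //.
  by apply/polyP => j; rewrite coef_take_poly coef0; case: ifP => // /q0.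
have M0 : 0 <= szasz_const del A r.
  rewrite /szasz_const mulr_ge0 ?expR_ge0 //.
  exact: le_trans (nrm_ge0 _) (hA v 0%N v12 isT).
have [kd|dk] := ltnP (mdeg k) d.
  by rewrite q0 // nrm0 mul0r mulr_ge0 // ltW.
have qS t : 0 < Im t -> (drop_poly d q).[t] != 0.
  move=> t0; have : q.[t] != 0.
    rewrite horner_line; apply: pS => i; rewrite /H0 /= add0r ImZ mulr_gt0 //.
  by rewrite {1}qE hornerM mulf_eq0 negb_or => /andP[].
have qd : del <= nrm (drop_poly d q)`_0.
  rewrite coef_drop_poly add0n -meval_hpart; apply: le_trans hdel _.
  by apply: nrm_hpart_mono => // i; have /andP[] := v12 i.
have qA j : (j < 3)%N -> nrm (drop_poly d q)`_j <= A.
  by move=> j3; rewrite coef_drop_poly addnC; exact: hA.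
have := @szasz_coef R (drop_poly d q) del A r (mdeg k - d) del0 (ltW r0) qS qd qA.
rewrite coef_drop_poly subnK // => h.
rewrite -[in r ^+ mdeg k](subnK dk) exprD mulrA ler_wpM2r // ltW //.
Qed.

End HomogeneousParts.

(** * Superexponential decay of the limit coefficients *)

Section StableLimit.
Variables (R : realType) (m : nat).
Local Notation C := R[i].

(** With [d] the lowest degree in [c], the constants in Szasz' bound only depend on degrees [d] to
    [d + 2], where the [s l] converge. They can thus be chosen independently of large [l], and the
    bound passes to the limit. *)
Lemma entire_coefs_of_stable (c : 'X_{1..m} -> C) (theta : nat -> 'X_{1..m} -> R)
    (s : nat -> {mpoly C[m]}) :
  (forall k kk, 0 <= theta k kk <= 1) ->
  (forall kk, (fun k => theta k kk) @ \oo --> (1 : R)) ->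
  (forall k kk, (s k)@_kk = c kk * (theta k kk)%:C%C) ->
  (forall k, stable (s k)) -> entire_coefs c.
Proof.
move=> th01 th1 sE sS.
have [k0 ck0] : exists k, c k != 0.
  apply: contrapT => h; have := sS 0%N (fun=> 'i%C).
  have -> : s 0%N = 0.
    apply/mpolyP => k; rewrite sE mcoeff0; have [->|ck] := eqVneq (c k) 0; first by rewrite mul0r.
    by case: h; exists k.
  by rewrite meval0 eqxx => /(_ (fun i => ltr01)).
have : exists d, `[< exists2 k, mdeg k = d & c k != 0 >].
  by exists (mdeg k0); apply/asboolP; exists k0.
case/ex_minnP => d /asboolP[k1 k1d ck1] dmin.
have clow k : (mdeg k < d)%N -> c k = 0.
  move=> kd; apply/eqP; apply: contraTT kd => ck; rewrite -leqNgt.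
  by apply: dmin; apply/asboolP; exists k.
have slow l k : (mdeg k < d)%N -> (s l)@_k = 0 by move=> /clow ck; rewrite sE ck mul0r.
have [A1 hA1] := low_fset m (d + 3).
have hpartE e (c' : 'X_{1..m} -> C) q : (e < d + 3)%N -> (forall k, q@_k = c' k \/ (k \notin A1)) ->
    hpart e q = fpoly (fun k => c' k * (mdeg k == e)%:R) A1.
  move=> ed qc; apply/mpolyP => k; rewrite mcoeff_hpart mcoeff_fpoly.
  case: ifP => [kA|/negP kA]; first by case: (qc k) => [->|/negP].
  have [ke|_] := eqVneq (mdeg k) e; last by rewrite mulr0.
  by case: kA; rewrite hA1 ke.
have FE e l : (e < d + 3)%N -> hpart e (s l) =
    fpoly (fun k => (c k * (mdeg k == e)%:R) * (theta l k)%:C%C) A1.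
  move=> ed; rewrite (hpartE e (fun k => c k * (theta l k)%:C%C)) // => [|k]; last by left.
  by apply: eq_bigr => k _; rewrite mulrAC.
pose F0 := hpart d (fpoly c A1).
have F0E : F0 = fpoly (fun k => c k * (mdeg k == d)%:R) A1.
  apply: hpartE => [|k]; first by rewrite -[ltnLHS]addn0 ltn_add2l.
  by rewrite mcoeff_fpoly; case: ifP; [left|right].
have d3 : (d < d + 3)%N by rewrite -[ltnLHS]addn0 ltn_add2l.
have sF0 : loc_cvg (fun l => hpart d (s l)) F0.
  have h := @loc_cvg_fpoly R m (fun k => c k * (mdeg k == d)%:R) theta A1 th1.
  by rewrite F0E; apply: loc_cvg_eq h => l; rewrite FE.
have F0S : stable F0.
  case: (hurwitz (fun l => stable0_hpart (sS l) (slow l)) sF0) => // F00.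
  have := mcoeff_hpart d (fpoly c A1) k1; rewrite -/F0 F00 mcoeff0 k1d eqxx mulr1.
  rewrite mcoeff_fpoly hA1 k1d d3 => /esym/eqP; by rewrite (negPf ck1).
(* Stability gives a nonzero value at [(i, ..., i)], and homogeneity carries it over to the real
   point. *)
have F01 : F0.@[fun=> 1] != 0.
  have := F0S (fun=> 'i%C * 1); rewrite meval_hpartZ => /(_ _)/negP h.
  apply/negP => /eqP F00; apply: h => [i|]; first by rewrite mulr1 /H0 /= ltr01.
  by rewrite -/F0 F00 mulr0.
pose del := nrm F0.@[fun=> 1] / 2.
have del0 : 0 < del by rewrite divr_gt0 // nrm_gt0.
have hdel : \forall l \near \oo, del <= nrm (hpart d (s l)).@[fun=> 1].
  apply: filterS (sF0 1 _ del0) => l /(_ (fun=> 1)); rewrite nrm1 lexx => /(_ (fun _ => isT)).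
  have := nrm_lerB F0.@[fun=> 1] (hpart d (s l)).@[fun=> 1].
  rewrite [nrm (F0.@[_] - _)]nrm_distC /del; lra.
pose A := \sum_(k <- A1) nrm (c k) * 2 ^+ mdeg k.
have hA l (v : 'I_m -> R) j : (forall i, 1 <= v i <= 2) -> (j < 3)%N ->
    nrm (line (fun=> 0) (fun i => (v i)%:C%C) (s l))`_(d + j) <= A.
  move=> v12 j3; rewrite -meval_hpart FE ?ltn_add2l // meval_fpoly.
  rewrite (le_trans (nrm_sum _ _ _)) //; apply: ler_sum => k _.
  have v2 i : nrm (v i)%:C%C <= 2.
    by have /andP[h1 h2] := v12 i; rewrite nrm_real ger0_norm // (le_trans ler01).
  apply: le_trans (nrm_pterm _ _ v2) _; rewrite ler_wpM2r ?exprn_ge0 //.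
  have /andP[t0 t1] := th01 l k; rewrite !nrmM nrm_real ger0_norm // nrm_nat -mulrA.
  by rewrite ler_piMr ?nrm_ge0 // mulr_ile1 //; case: eqP.
(* The radius [rho * fd_rate] absorbs the geometric loss from the finite differences. *)
move=> rho rho0; have fd0 : 0 < fd_rate R by rewrite mulr_gt0 // expR_gt0.
pose r := rho * fd_rate R; have r0 : 0 < r by rewrite mulr_gt0.
exists (szasz_const del A r * r ^+ d) => k.
have X1 : (fun l => nrm (c k) * rho ^+ mdeg k * theta l k) @ \oo --> nrm (c k) * rho ^+ mdeg k * 1.
  by apply: cvgMr; exact: th1.
rewrite -[leLHS]mulr1; apply: ler_cvg_to X1 (cvg_cst _) _.
apply: filterS hdel => l hl.
have hS : stable (hpart d (s l)).
  case: (stable0_hpart (sS l) (slow l)) => // h0; move: hl; rewrite h0 meval0 nrm0.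
  by rewrite leNgt del0.
have := stable_coef_bound (sS l) (slow l) hS del0 hl (hA l) r0 k.
rewrite sE nrmM nrm_real ger0_norm; last by have /andP[] := th01 l k.
rewrite /r exprMn [rho ^+ _ * _]mulrC mulrCA ler_pM2l ?exprn_gt0 //.
by rewrite mulrAC.
Qed.

End StableLimit.
(** * Preservers of stability *)

Section Preservers.
Variables (R : realType) (n : nat).
Local Notation C := R[i].
Variable T : {linear {mpoly C[n]} -> {mpoly C[n]}}.
Implicit Types (f g p q : {mpoly C[n]}) (w z : 'I_n -> C).

Definition boxprod N w : {mpoly C[n]} := \prod_i ('X_i + (w i)%:MP) ^+ N.

Definition inbox N f := forall k, k \in msupp f -> forall i, (k i <= N)%N.

Definition stable0_on_box N := forall g, inbox N g -> stable0 (T g).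

Lemma meval_boxprod N w z : (boxprod N w).@[z] = \prod_i (z i + w i) ^+ N.
Proof.
rewrite /boxprod rmorph_prod; apply: eq_bigr => i _.
by rewrite rmorphXn rmorphD /= mevalXU mevalC.
Qed.

Lemma ImD_neq0 (x y : C) : 0 < Im x -> 0 < Im y -> x + y != 0.
Proof.
by move=> x0 y0; apply/eqP => /(congr1 Im); rewrite ImD /=; move/eqP; rewrite gt_eqF // addr_gt0.
Qed.

Lemma stable_boxprod N w : (forall i, H0 (w i)) -> stable (boxprod N w).
Proof.
move=> wH z zH; rewrite meval_boxprod; apply/prodf_neq0 => i _.
by rewrite expf_neq0 // ImD_neq0 //; [exact: zH|exact: wH].
Qed.

(* [boxprod N w] stays away from 0 and dominates every monomial of the box on
   the product of half planes, so it can be perturbed by any [g] in the box. *)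
Lemma boxprod_perturb N w g : (forall i, H0 (w i)) -> inbox N g ->
  exists2 e : C, e != 0 & stable (boxprod N w + e *: g).
Proof.
move=> wH gN.
(* Chosen so that [c i * |x + w i|] dominates both [|x|] and 1, using [Im (w i) <= |x + w i|] and
   [|x| <= |x + w i| + |w i|]. *)
pose c i := (1 + nrm (w i)) / Im (w i) + 1.
have c0 i : 0 <= c i by rewrite addr_ge0 // divr_ge0 ?addr_ge0 ?nrm_ge0 // ltW //; exact: wH.
have cP i (x : C) : 0 < Im x -> nrm x <= c i * nrm (x + w i) /\ 1 <= c i * nrm (x + w i).
  move=> x0; have w0 : 0 < Im (w i) by exact: wH.
  have h : Im (w i) <= nrm (x + w i).
    by rewrite (le_trans _ (Im_le_nrm _)) // ImD (le_trans _ (ler_norm _)) // lerDr ltW.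
  have h2 : 1 <= nrm (x + w i) / Im (w i) by rewrite ler_pdivlMr // mul1r.
  have h3 : nrm x <= nrm (x + w i) + nrm (w i).
    by rewrite -{1}[x](addrK (w i)) nrmB.
  have nw : 0 <= nrm (w i) by exact: nrm_ge0.
  have nx : 0 <= nrm (x + w i) by exact: nrm_ge0.
  have -> : c i * nrm (x + w i) = (1 + nrm (w i)) * (nrm (x + w i) / Im (w i)) + nrm (x + w i).
    by rewrite /c; field; rewrite gt_eqF.
  by split; nra.
pose B := \sum_(k <- msupp g) nrm g@_k * \prod_i c i ^+ N.
have B0 : 0 <= B.
  apply: sumr_ge0 => k _; rewrite mulr_ge0 ?nrm_ge0 // prodr_ge0 // => i _.
  by rewrite exprn_ge0.
have B1 : 0 < B + 1 by rewrite ltr_wpDl.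
have gB z : (forall i, H0 (z i)) -> nrm g.@[z] <= B * nrm (boxprod N w).@[z].
  move=> zH; rewrite mevalE (le_trans (nrm_sum _ _ _)) // /B mulr_suml big_seq [leRHS]big_seq.
  apply: ler_sum => k kg; rewrite nrmM -mulrA ler_wpM2l ?nrm_ge0 //.
  rewrite meval_boxprod !nrm_prod -big_split /=; apply: ler_prod => i _.
  have [h1 h2] := cP i (z i) (zH i).
  rewrite nrm_ge0 !nrmX -exprMn /= (@le_trans _ _ ((c i * nrm (z i + w i)) ^+ k i)) //.
    by rewrite lerXn2r // nnegrE ?nrm_ge0 // mulr_ge0 // nrm_ge0.
  by rewrite ler_weXn2l // gN.
exists ((B + 1)^-1)%:C%C => [|z zH].
  by rewrite -nrm_gt0 nrm_real normr_gt0 invr_eq0 gt_eqF.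
have b0 := stable_boxprod N wH zH.
rewrite mevalD mevalZ; apply/eqP => E.
have hb : nrm (boxprod N w).@[z] = (B + 1)^-1 * nrm g.@[z].
  move/eqP: E; rewrite addr_eq0 => /eqP ->.
  by rewrite nrmN nrmM nrm_real ger0_norm // invr_ge0 ltW.
have : nrm (boxprod N w).@[z] <= (B + 1)^-1 * (B * nrm (boxprod N w).@[z]).
  by rewrite {1}hb ler_wpM2l ?invr_ge0 ?(ltW B1) //; exact: gB.
rewrite mulrA -[leLHS]mul1r ler_pM2r ?nrm_gt0 // mulrC ler_pdivlMr // mul1r.
by rewrite leNgt ltrDl ltr01.
Qed.

Lemma stable0Z (e : C) p : e != 0 -> stable0 (e *: p) -> stable0 p.
Proof.
move=> e0 [pS|/eqP]; [left => z /pS|].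
  by rewrite mevalZ mulf_eq0 negb_or => /andP[].
by rewrite scaler_eq0 (negPf e0) => /eqP; right.
Qed.

(** On the perturbed product [T] takes the value [e * T g], as the product itself is killed. *)
Lemma stable0_on_box_of_zero N w : preserves_stability T -> (forall i, H0 (w i)) -> T (boxprod N
  w) = 0 ->
  stable0_on_box N.
Proof.
move=> TP wH T0 g gN; have [e e0 /TP] := boxprod_perturb wH gN.
by rewrite linearD linearZ /= T0 add0r; exact: stable0Z.
Qed.

Lemma stable_T_boxprod N w : preserves_stability T -> ~ stable0_on_box N ->
  (forall i, H0 (w i)) -> stable (T (boxprod N w)).
Proof.
move=> TP nR wH; case: (TP _ (stable_boxprod N wH)) => // T0.
by case: nR; exact: stable0_on_box_of_zero TP wH T0.
Qed.

End Preservers.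

(** * The degenerate case of rank at most one *)

Section RankOne.
Variables (R : realType) (n : nat).
Local Notation C := R[i].

Definition eval_form (T : {linear {mpoly C[n]} -> {mpoly C[n]}}) (a : C) (z : 'I_n -> C)
  (f : {mpoly C[n]}) : C := a * (T f).@[z].

Fact eval_form_is_scalar T a z : scalar (eval_form T a z).
Proof.
by move=> b f g; rewrite /eval_form linearP mevalD mevalZ mulrDr mulrCA.
Qed.

HB.instance Definition _ T a z :=
  GRing.isLinear.Build C {mpoly C[n]} C _ (eval_form T a z) (eval_form_is_scalar T a z).

(* A combination of [T f] and [T g] vanishing at a point of the half plane is
   not stable, hence it is 0. *)
Lemma rank_one (T : {linear {mpoly C[n]} -> {mpoly C[n]}}) :
  (forall g, stable0 (T g)) ->
  exists (alpha : {scalar {mpoly C[n]}}) (P : {mpoly C[n]}),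
    stable P /\ forall f, T f = alpha f *: P.
Proof.
move=> TS; pose z0 : 'I_n -> C := fun=> 'i%C.
have z0H i : H0 (z0 i) by rewrite /H0 /= ltr01.
have [[f0 f00]|T0] := pselect (exists f, T f != 0); last first.
  (* For [T = 0], the zero form and the stable polynomial 1 serve. *)
  exists (eval_form T 0 z0 : {scalar _}), 1; split=> [z _|f]; first by rewrite meval1 oner_eq0.
  rewrite /= /eval_form mul0r scale0r; apply: contrapT => /eqP fN0.
  by apply: T0; exists f.
have PS : stable (T f0) by case: (TS f0) => // h; rewrite h eqxx in f00.
have Pz := PS z0 z0H.
exists (eval_form T (T f0).@[z0]^-1 z0 : {scalar _}), (T f0); split=> // f /=.
apply/eqP; rewrite -subr_eq0; apply/eqP; rewrite /eval_form.
pose a := (T f0).@[z0]^-1 * (T f).@[z0]; rewrite -/a.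
have E : T (f - a *: f0) = T f - a *: T f0 by rewrite linearB; congr (_ - _); exact: linearZ.
case: (TS (f - a *: f0)); rewrite E // => /(_ z0 z0H).
by rewrite mevalB mevalZ /a mulrAC mulVf // mul1r subrr eqxx.
Qed.

End RankOne.

(** * Stable polynomial approximants of the symbol *)

Section Approximants.
Variables (R : realType) (n : nat).
Local Notation C := R[i].
Variable T : {linear {mpoly C[n]} -> {mpoly C[n]}}.

Definition mnm_of N (f : {ffun 'I_n -> 'I_N.+1}) : 'X_{1..n} := [multinom (f i : nat) | i < n].

(** The factor between the coefficients of [approx N] and those of the series; only the exponents of
    [w] matter. *)
Definition ffact_weight N (k : 'X_{1..n + n}) : R := \prod_(i < n) ffact_ratio R N (k (rshift n i)).

(* [approx N] is [T[prod_i (1 - z_i w_i / N) ^ N]], [T] acting on [z]. *)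
Definition approx N : {mpoly C[n + n]} :=
  \sum_(f : {ffun 'I_n -> 'I_N.+1})
    monmap (fun=> (\prod_i ffact_ratio R N (f i))%:C%C) (fun be =>
      mjoin be (mnm_of f)) (symbol T (mnm_of f)).

Lemma mcoeff_monmap_join (a : C) al (q : {mpoly C[n]}) (k : 'X_{1..n + n}) :
  (monmap (fun=> a) (fun be => mjoin be al) q)@_k = a * q@_(mfst k) *+ (msnd k == al).
Proof.
elim/mpolyind: q => [|b k' q _ _ IH]; first by rewrite linear0 !mcoeff0 mulr0 mul0rn.
rewrite linearP /= monmapX !(mcoeffD, mcoeffZ) IH !mcoeffX mulrDr mulrnDl; congr (_ + _).
rewrite [mjoin _ _ == _]eq_sym eq_mjoin [k' == _]eq_sym; do 2!case: eqP => _ //=.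
all: by rewrite ?mulr1 ?mulr0 ?mulr0n ?mulr1n ?mulr0 // mulrC.
Qed.

Lemma mcoeff_approx N k : (approx N)@_k = joint_series (symbol T) k * (ffact_weight N k)%:C%C.
Proof.
rewrite /approx (raddf_sum (mcoeff k)) /=.
under eq_bigr do rewrite mcoeff_monmap_join.
(* If an exponent of [w] exceeds [N], no summand contributes, and the falling factorial on the right
   vanishes too. *)
have [kN|/existsNP[i /negP]] := pselect (forall i : 'I_n, (k (rshift n i) < N.+1)%N); last first.
  rewrite -leqNgt => ki.
  have t0 : ffact_weight N k = 0.
    by rewrite /ffact_weight (bigD1 i) //= (_ : ffact_ratio R N (k (rshift n i)) = 0) ?mul0r //
      /ffact_ratio ffact_small // mul0r.
  rewrite t0 mulr0 big1 // => f _.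
  case: eqP => // /mnmP/(_ i); rewrite !mnmE => fi; have := ltn_ord (f i).
  by rewrite -fi ltnNge ki.
pose f0 : {ffun 'I_n -> 'I_N.+1} := [ffun i => inord (k (rshift n i))].
have f0E i : f0 i = k (rshift n i) :> nat by rewrite ffunE inordK //; exact: kN.
have kf0 : msnd k = mnm_of f0 by apply/mnmP => i; rewrite !mnmE f0E.
rewrite (bigD1 f0) //= kf0 eqxx mulr1n [X in _ + X]big1 ?addr0 => [|f ff0]; last first.
  case: eqP => // /mnmP h; case/eqP: ff0; apply/ffunP => i; apply/val_inj.
  by have := h i; rewrite !mnmE.
rewrite mulrC /joint_series -/(msnd k) -/(mfst k) kf0; congr (_ * _%:C%C).
by apply: eq_bigr => i _; rewrite f0E.
Qed.

Lemma ffact_weight_01 N k : 0 <= ffact_weight N k <= 1.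
Proof.
rewrite prodr_ge0 /= => [|i _]; last exact: ffact_ratio_ge0.
by apply: prodr_ile1 => i _; rewrite ffact_ratio_ge0 ffact_ratio_le1.
Qed.

Lemma cvg_prod1 I (l : seq I) (u : I -> nat -> R) :
  (forall i, u i @ \oo --> (1 : R)) -> (fun N => \prod_(i <- l) u i N) @ \oo --> (1 : R).
Proof.
move=> u1; elim: l => [|i l IH].
  by under eq_fun do rewrite big_nil; exact: cvg_cst.
under eq_fun do rewrite big_cons.
have : (fun N => u i N * \prod_(j <- l) u j N) @ \oo --> (1 * 1 : R) by exact: cvgM.
by rewrite mulr1.
Qed.

Lemma ffact_weight_cvg k : (fun N => ffact_weight N k) @ \oo --> (1 : R).
Proof. by apply: cvg_prod1 => i; exact: ffact_ratio_cvg. Qed.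

(** Both sides are the product of the [(1 - z_i w_i / N)^N]: expanded by the binomial theorem on the
    left, with [- w_i / N] factored out on the right. *)
Lemma boxprod_expand N (w : 'I_n -> C) : (0 < N)%N -> (forall i, w i != 0) ->
  \sum_(f : {ffun 'I_n -> 'I_N.+1})
    (\prod_i ffact_ratio R N (f i))%:C%C * ((-1) ^+ mdeg (mnm_of f) / (mfactorial (mnm_of f))%:R)
      * \prod_i w i ^+ f i *: 'X_[mnm_of f] =
  \prod_i (- (w i / N%:R)) ^+ N *: boxprod N (fun i => - (N%:R / w i)).
Proof.
move=> N0 w0; have NC : (N%:R : C) != 0 by rewrite pnatr_eq0 -lt0n.
transitivity (\prod_i (1 + (- (w i / N%:R)) *: 'X_i) ^+ N : {mpoly C[n]}); last first.
  rewrite /boxprod -scaler_prod; apply: eq_bigr => i _; rewrite -exprZn; congr (_ ^+ _).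
  rewrite scalerDr addrC; congr (_ + _).
  rewrite -mul_mpolyC -mpolyCM mulrNN mulrA divfK // divff //.
under [RHS]eq_bigr do rewrite exprDn.
rewrite bigA_distr_bigA /=; apply: eq_bigr => f _.
have facE a (x : C) : (ffact_ratio R N a)%:C%C * ((-1) ^+ a / a`!%:R) * x ^+ a =
    'C(N, a)%:R * (- (x / N%:R)) ^+ a.
  have a0 : (a`!%:R : C) != 0 by rewrite pnatr_eq0 -lt0n fact_gt0.
  rewrite /ffact_ratio fmorph_div rmorphXn /= !rmorph_nat -bin_ffact natrM [(- (x / _)) ^+
    a]exprNn expr_div_n.
  by field; rewrite a0 expf_neq0.
transitivity ((\prod_i ('C(N, f i)%:R * (- (w i / N%:R)) ^+ f i)) *: \prod_i 'X_i ^+ f i :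
  {mpoly C[n]}).
  congr (_ *: _); last by rewrite mpolyXE_id; apply: eq_bigr => i _; rewrite mnmE.
  rewrite rmorph_prod -(eq_bigr _ (fun i _ => facE (f i) (w i))) !big_split /=.
  congr (_ * (_ * _) * _).
    by rewrite mdegE -prodrXr; apply: eq_bigr => i _; rewrite mnmE.
  by rewrite /mfactorial natr_prod -prodfV; apply: eq_bigr => i _; rewrite mnmE.
rewrite -scaler_prod; apply: eq_bigr => i _.
by rewrite expr1n mul1r exprZn -scalerA scaler_nat.
Qed.

Lemma meval_approx N (y : 'I_(n + n) -> C) : (0 < N)%N -> (forall i, y (rshift n i) != 0) ->
  (approx N).@[y] = \prod_i (- (y (rshift n i) / N%:R)) ^+ N *
    (T (boxprod N (fun i => - (N%:R / y (rshift n i))))).@[fun i => y (lshift n i)].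
Proof.
move=> N0 y0; rewrite -mevalZ -linearZ -boxprod_expand // linear_sum !raddf_sum /=.
apply: eq_bigr => f _; rewrite meval_monmap linearZ mevalZ.
transitivity ((\prod_i ffact_ratio R N (f i))%:C%C * \prod_i y (rshift n i) ^+ f i *
    (symbol T (mnm_of f)).@[fun i => y (lshift n i)]); last first.
  by rewrite /symbol mevalZ; ring.
rewrite mevalE mulr_sumr; apply: eq_bigr => k _; rewrite prod_mjoin.
under [X in _ * (_ * X) = _]eq_bigr do rewrite mnmE.
ring.
Qed.

(** At fixed [w], [approx N] is a nonzero multiple of [T] applied to [boxprod] with shifts
    [- N / w_i], which lie in the upper half plane if the [w_i] do. *)
Lemma stable_approx N : preserves_stability T -> ~ stable0_on_box T N -> (0 < N)%N ->
  stable (approx N).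
Proof.
move=> TP nR N0 y yH; have NC : (N%:R : C) != 0 by rewrite pnatr_eq0 -lt0n.
have y0 i : y (rshift n i) != 0.
  by apply/eqP => y0; have := yH (rshift n i); rewrite /H0 /= y0 /= ltxx.
rewrite meval_approx // mulf_neq0 //.
  by apply/prodf_neq0 => i _; rewrite expf_neq0 // oppr_eq0 mulf_neq0 // invr_eq0.
apply: (stable_T_boxprod TP nR) => i; last exact: yH.
rewrite /H0 /= ImN -(rmorph_nat (real_complex R)) ImZ ImV mulNr mulrN opprK.
rewrite mulr_gt0 ?ltr0n // divr_gt0 ?exprn_gt0 ?nrm_gt0 //; exact: yH.
Qed.

End Approximants.

(** * The characterization of stability preservers *)

Section MainProof.
Variables (R : realType) (n : nat).
Local Notation C := R[i].
Variable T : {linear {mpoly C[n]} -> {mpoly C[n]}}.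

Lemma entire_of_preserver N0 : preserves_stability T -> ~ stable0_on_box T N0 ->
  exists F : 'rV[C^o]_(n + n) -> C^o,
      is_entire_function (joint_series (symbol T)) F /\ compact_limit_of_stable F.
Proof.
move=> TP nR.
(* The shift makes the index positive and larger than [N0]; the box of [N0] is contained in all
   these boxes, so none of them is degenerate. *)
pose s k := approx T (k + N0.+1); pose th k := @ffact_weight R n (k + N0.+1).
have sS k : stable (s k).
  apply: stable_approx => //; last by rewrite addnS.
  by move=> h; apply: nR => g gN; apply: h => k' k'g i;
    rewrite (leq_trans (gN _ k'g i)) // addnS ltnW // ltnS leq_addl.
have th01 k kk : 0 <= th k kk <= 1 by exact: ffact_weight_01.
have th1 kk : (fun k => th k kk) @ \oo --> (1 : R).
  move=> P /(@ffact_weight_cvg R n kk)[K _ hK]; exists K => // k Kk.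
  by apply: hK; rewrite /= (leq_trans Kk) // leq_addr.
have sE k kk : (s k)@_kk = joint_series (symbol T) kk * (th k kk)%:C%C by exact: mcoeff_approx.
have [F [FE sF]] := entire_limit (entire_coefs_of_stable th01 th1 sE sS) th01 th1 sE.
by exists F; split=> //; exists s.
Qed.

End MainProof.

Theorem theorem2p3 (R : realType) (n : nat) (hn : (1 <= n)%N)
    (T : {linear {mpoly R[i][n]} -> {mpoly R[i][n]}}) :
  preserves_stability T <->
  ((range_dim_le1 T /\
    exists (alpha : {scalar {mpoly R[i][n]}}) (P : {mpoly R[i][n]}),
      stable P /\ forall f, T f = alpha f *: P) \/
   (exists F : 'rV[R[i]^o]_(n + n) -> R[i]^o,
      is_entire_function (joint_series (symbol T)) F /\
      compact_limit_of_stable F)).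
Proof.
split=> [TP|[[_ [alpha [P [PS TE]]]]|[F [FE [p [pS pF]]]]] f fS]; last first.
- exact: stable0_of_coef_cvg pS (coef_cvg_of_compact_limit FE pF) fS.
- rewrite TE; have [->|a0] := eqVneq (alpha f) 0; first by right; rewrite scale0r.
  by left => z /PS Pz; rewrite mevalZ mulf_neq0.
(* Either all boxes are degenerate, which leads to (a), or one of them is not, which leads to
   (b). *)
have [h|/existsNP[N0 nR]] := pselect (forall N, stable0_on_box T N); last first.
  by right; exact: entire_of_preserver nR.
left; have [|alpha [P [PS TE]]] := @rank_one R n T.
  (* Every polynomial lies in the box given by its own size. *)
  move=> g; apply: (h (msize g)) => k /msize_mdeg_lt kg i.
  by rewrite (leq_trans _ (ltnW kg)) // mdegE (bigD1 i) ?leq_addr.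
split; last by exists alpha, P.
by exists P => f; exists (alpha f).
Qed.
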